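(* Let $\alpha_i:(F_0,A_0)\to(F_i,A_i)$, $i=1,2$, be morphisms of relative graphs, and let $(E,A)$ be their pushout. If $(\alpha_1,\alpha_2)$ is admissible, then the commutative square of canonical surjections $$C^*(E,A)\to C^*(F_1,A_1),\quad C^*(E,A)\to C^*(F_2,A_2),\quad C^*(F_1,A_1)\to C^*(F_0,A_0),\quad C^*(F_2,A_2)\to C^*(F_0,A_0)$$ is a pullback diagram in the category of $\mathbb T$-$C^*$-algebras and $\mathbb T$-equivariant $*$-homomorphisms (for the canonical gauge actions).
   Context: A directed graph $E=(E^0,E^1,r,s)$ has vertex set $E^0$, edge set $E^1$ and range and source maps $r,s:E^1\to E^0$; $\operatorname{reg}(E)=\{v\in E^0:0<|s^{-1}(v)|<\infty\}$. A relative graph is a pair $(E,R)$ with $E$ a directed graph and $R\subseteq\operatorname{reg}(E)$. A subset $H\subseteq E^0$ is hereditary in $E$ if $s(e)\in H$ implies $r(e)\in H$ for all $e\in E^1$. A morphism of relative graphs $\alpha:(F,B)\to(E,A)$ is an injective graph homomorphism $F\hookrightarrow E$, viewed as an inclusion, such that (i) $E^0\setminus F^0$ is hereditary in $E$; (ii) $F^1=F^0E^1F^0:=\{e\in E^1: s(e),r(e)\in F^0\}$; (iii) $A\cap F^0\subseteq B$. The pushout of $\alpha_1,\alpha_2$ is the relative graph $(E,A)$ where $E=F_1\sqcup_{F_0}F_2$, that is, $E^0=(F_1^0\sqcup F_2^0)/\{\alpha_1(v)=\alpha_2(v):v\in F_0^0\}$, $E^1=(F_1^1\sqcup F_2^1)/\{\alpha_1(e)=\alpha_2(e):e\in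 F_0^1\}$, with range and source maps induced from those of $F_1,F_2$, and $$A=(A_1\setminus F_0^0)\cup(A_2\setminus F_0^0)\cup(A_1\cap A_2),$$ with $F_0,F_1,F_2$ regarded as subgraphs of $E$. The pair $(\alpha_1,\alpha_2)$ is admissible if $A_0\subseteq A_1\cup A_2$. The relative graph $C^*$-algebra $C^*(E,R)$ is the universal $C^*$-algebra generated by mutually orthogonal projections $p_v$ ($v\in E^0$) and partial isometries $s_e$ ($e\in E^1$) with mutually orthogonal ranges such that $s_e^*s_e=p_{r(e)}$, $s_es_e^*\le p_{s(e)}$, and $p_v=\sum_{s(e)=v}s_es_e^*$ for all $v\in R$. Its canonical gauge action of $\mathbb T$ is $\gamma_z(p_v)=p_v$, $\gamma_z(s_e)=zs_e$. For a morphism $(F,B)\to(E,A)$, the canonical surjection $C^*(E,A)\to C^*(F,B)$ sends $p_v,s_e$ to $p_v,s_e$ for $v\in F^0$, $e\in F^1$, and all other generators to $0$. A $\mathbb T$-$C^*$-algebra is a $C^*$-algebra with a strongly continuous action of $\mathbb T$. A commutative square of $\mathbb T$-equivariant $*$-homomorphisms $\rho_1:P\to A$, $\rho_2:P\to B$, $\mu_1:A\to C$, $\mu_2:B\to C$ is a pullback diagram if $p\mapsto(\rho_1(p),\rho_2(p))$ is a $\mathbb T$-equivariant $*$-isomorphism of $P$ onto $A\oplus_CB=\{(a,b)\in A\oplus B:\mu_1(a)=\mu_2(b)\}$ with the componentwise action. *)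

(* Defs.v *)
From HB Require Import structures.
From Stdlib Require Import Relation_Operators.
From mathcomp Require Import all_boot all_order all_algebra.
From mathcomp Require Import generic_quotient complex.
From mathcomp Require Import all_classical all_reals all_analysis.
Set Implicit Arguments.
Unset Strict Implicit.
Unset Printing Implicit Defensive.
Import Order.TTheory GRing.Theory Num.Theory.
Import numFieldNormedType.Exports.
Local Open Scope classical_set_scope.
Local Open Scope ring_scope.
Local Open Scope complex_scope.
Local Open Scope quotient_scope.

(* MathComp rings are unital, so the (possibly non-unital) product is a
   separate operation [cmul]. The norm of a normed module over [R[i]] takes
   its values in the nonnegative reals inside [R[i]]. *)
HB.mixin Record isCStarAlgebra (R : realType) V
    & CompleteNormedModule R[i] V := {
  cmul : V -> V -> V;
  cstar : V -> V;
  cmulA : forall x y z : V, cmul x (cmul y z) = cmul (cmul x y) z;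
  cmulDl : forall x y z : V, cmul (x + y) z = cmul x z + cmul y z;
  cmulDr : forall x y z : V, cmul x (y + z) = cmul x y + cmul x z;
  cmulZl : forall (a : R[i]) (x y : V), cmul (a *: x) y = a *: cmul x y;
  cmulZr : forall (a : R[i]) (x y : V), cmul x (a *: y) = a *: cmul x y;
  cstarK : forall x : V, cstar (cstar x) = x;
  cstarD : forall x y : V, cstar (x + y) = cstar x + cstar y;
  cstarZ : forall (a : R[i]) (x : V), cstar (a *: x) = a^* *: cstar x;
  cstarM : forall x y : V, cstar (cmul x y) = cmul (cstar y) (cstar x);
  cnormM : forall x y : V, `|cmul x y| <= `|x| * `|y|;
  cnorm_star : forall x : V, `|cmul (cstar x) x| = `|x| ^+ 2
}.

#[short(type="cstarAlgType")]
HB.structure Definition CStarAlgebra (R : realType) :=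
  {V of CompleteNormedModule R[i] V & isCStarAlgebra R V}.

Section CStarTheory.
Context {R : realType} {A : cstarAlgType R}.
Implicit Types x y : A.

Lemma cmul0x x : cmul 0 x = 0.
Proof. by rewrite -(scale0r (0 : A)) cmulZl !scale0r. Qed.

Lemma cmulx0 x : cmul x 0 = 0.
Proof. by rewrite -(scale0r (0 : A)) cmulZr !scale0r. Qed.

Lemma cstar0 : cstar (0 : A) = 0.
Proof. by rewrite -(scale0r (0 : A)) cstarZ rmorph0 !scale0r. Qed.

End CStarTheory.

(* The norm of the direct sum is the maximum norm that the library puts on
   products. *)
Section DirectSum.
Context {R : realType} (A B : cstarAlgType R).

Definition dsum_mul (x y : A * B) : A * B := (cmul x.1 y.1, cmul x.2 y.2).
Definition dsum_star (x : A * B) : A * B := (cstar x.1, cstar x.2).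

Let dsum_mulA (x y z : A * B) :
  dsum_mul x (dsum_mul y z) = dsum_mul (dsum_mul x y) z.
Proof. by rewrite /dsum_mul /= !cmulA. Qed.

Let dsum_mulDl (x y z : A * B) :
  dsum_mul (x + y) z = dsum_mul x z + dsum_mul y z.
Proof. by rewrite /dsum_mul /= !cmulDl. Qed.

Let dsum_mulDr (x y z : A * B) :
  dsum_mul x (y + z) = dsum_mul x y + dsum_mul x z.
Proof. by rewrite /dsum_mul /= !cmulDr. Qed.

Let dsum_mulZl (a : R[i]) (x y : A * B) :
  dsum_mul (a *: x) y = a *: dsum_mul x y.
Proof. by rewrite /dsum_mul /= !cmulZl. Qed.

Let dsum_mulZr (a : R[i]) (x y : A * B) :
  dsum_mul x (a *: y) = a *: dsum_mul x y.
Proof. by rewrite /dsum_mul /= !cmulZr. Qed.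

Let dsum_starK (x : A * B) : dsum_star (dsum_star x) = x.
Proof. by case: x => a b; rewrite /dsum_star /= !cstarK. Qed.

Let dsum_starD (x y : A * B) : dsum_star (x + y) = dsum_star x + dsum_star y.
Proof. by rewrite /dsum_star /= !cstarD. Qed.

Let dsum_starZ (a : R[i]) (x : A * B) :
  dsum_star (a *: x) = a^* *: dsum_star x.
Proof. by rewrite /dsum_star /= !cstarZ. Qed.

Let dsum_starM (x y : A * B) :
  dsum_star (dsum_mul x y) = dsum_mul (dsum_star y) (dsum_star x).
Proof. by rewrite /dsum_star /dsum_mul /= !cstarM. Qed.

Let dsum_normM (x y : A * B) : `|dsum_mul x y| <= `|x| * `|y|.
Proof.
rewrite !prod_normE /=.
have cx : `|x.1| >=< `|x.2| by exact: real_comparable.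
have cy : `|y.1| >=< `|y.2| by exact: real_comparable.
have x1 : `|x.1| <= Num.max `|x.1| `|x.2| by rewrite comparable_le_max// lexx.
have x2 : `|x.2| <= Num.max `|x.1| `|x.2|
  by rewrite comparable_le_max// lexx orbT.
have y1 : `|y.1| <= Num.max `|y.1| `|y.2| by rewrite comparable_le_max// lexx.
have y2 : `|y.2| <= Num.max `|y.1| `|y.2|
  by rewrite comparable_le_max// lexx orbT.
rewrite comparable_ge_max ?real_comparable//; apply/andP; split.
- by apply: (le_trans (cnormM _ _)); exact: ler_pM.
- by apply: (le_trans (cnormM _ _)); exact: ler_pM.
Qed.

Let dsum_norm_star (x : A * B) : `|dsum_mul (dsum_star x) x| = `|x| ^+ 2.
Proof.
rewrite !prod_normE /= !cnorm_star.
have cx : `|x.1| >=< `|x.2| by exact: real_comparable.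
have [le12|lt21] := comparable_leP cx.
- by rewrite max_r // ler_pXn2r // nnegrE.
- by rewrite max_l // ler_pXn2r ?nnegrE// ltW.
Qed.

HB.instance Definition _ := Pointed.on (A * B)%type.

Let dsum_complete (F : set_system (A * B)%type) :
  ProperFilter F -> cauchy F -> cvg F.
Proof.
move=> FF /cauchyP Fc.
have /cauchy_cvg F1 : cauchy (fst @ F).
  apply/cauchyP => e e0; have [z Fz] := Fc e e0.
  by exists z.1; rewrite /fmap /=; apply: filterS Fz => w [].
have /cauchy_cvg F2 : cauchy (snd @ F).
  apply/cauchyP => e e0; have [z Fz] := Fc e e0.
  by exists z.2; rewrite /fmap /=; apply: filterS Fz => w [].
apply/cvg_ex; exists (lim (fst @ F), lim (snd @ F)).
have cvF := cvg_pair F1 F2.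
move=> P /cvF PP; have {PP} : F [set x | P (x.1, x.2)] by exact: PP.
by apply: filterS => -[].
Qed.

HB.instance Definition _ := Uniform_isComplete.Build (A * B)%type dsum_complete.

HB.instance Definition _ := isCStarAlgebra.Build R (A * B)%type
  dsum_mulA dsum_mulDl dsum_mulDr dsum_mulZl dsum_mulZr
  dsum_starK dsum_starD dsum_starZ dsum_starM dsum_normM dsum_norm_star.

End DirectSum.

Record star_hom (R : realType) (A B : cstarAlgType R) (f : A -> B) : Prop := {
  star_homD : forall x y, f (x + y) = f x + f y;
  star_homZ : forall (a : R[i]) x, f (a *: x) = a *: f x;
  star_homM : forall x y, f (cmul x y) = cmul (f x) (f y);
  star_hom_star : forall x, f (cstar x) = cstar (f x)
}.

(* Through the coercion from sets to types, [unit_circle R] is the circle with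
   the topology induced from the complex plane; [R[i]^o] is [R[i]] seen as a
   normed module over itself, which carries that topology. *)
Definition unit_circle (R : realType) : set (R[i]^o) := [set z | `|z| = 1].
Arguments unit_circle R : clear implicits.

Section Circle.
Context {R : realType}.

Let circle1_subproof : (1 : R[i]^o) \in unit_circle R.
Proof. by rewrite inE /unit_circle /= normr1. Qed.

Definition circle1 : unit_circle R := SigSub circle1_subproof.

Let circle_mul_subproof (z w : unit_circle R) :
  (val z * val w : R[i]^o) \in unit_circle R.
Proof.
have := valP z; have := valP w; rewrite !inE /unit_circle /= => w1 z1.
by rewrite normrM z1 w1 mulr1.
Qed.

Definition circle_mul (z w : unit_circle R) : unit_circle R :=
  SigSub (circle_mul_subproof z w).

End Circle.

Record circle_action (R : realType) (A : cstarAlgType R)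
    (g : unit_circle R -> A -> A) : Prop := {
  circle_action_hom : forall z, star_hom (g z);
  circle_action1 : forall a, g circle1 a = a;
  circle_actionM : forall z w a, g (circle_mul z w) a = g z (g w a);
  circle_action_cts : forall a, continuous (fun z => g z a)
}.

Definition equivariant (R : realType) (A B : cstarAlgType R)
    (gA : unit_circle R -> A -> A) (gB : unit_circle R -> B -> B)
    (f : A -> B) : Prop :=
  forall z a, f (gA z a) = gB z (f a).

Definition dsum_action (R : realType) (A B : cstarAlgType R)
    (gA : unit_circle R -> A -> A) (gB : unit_circle R -> B -> B)
    (z : unit_circle R) (x : A * B) : A * B :=
  (gA z x.1, gB z x.2).

Definition fibre_product (R : realType) (A B C : cstarAlgType R)
    (mu1 : A -> C) (mu2 : B -> C) : set (A * B) :=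
  [set x | mu1 x.1 = mu2 x.2].

Record pullback_diagram (R : realType) (P A B C : cstarAlgType R)
    (gP : unit_circle R -> P -> P) (gA : unit_circle R -> A -> A)
    (gB : unit_circle R -> B -> B) (gC : unit_circle R -> C -> C)
    (rho1 : P -> A) (rho2 : P -> B) (mu1 : A -> C) (mu2 : B -> C) : Prop := {
  pullback_actions : [/\ circle_action gP, circle_action gA,
    circle_action gB & circle_action gC];
  pullback_homs : [/\ star_hom rho1, star_hom rho2, star_hom mu1 &
    star_hom mu2];
  pullback_equivariant : [/\ equivariant gP gA rho1, equivariant gP gB rho2,
    equivariant gA gC mu1 & equivariant gB gC mu2];
  pullback_comm : forall p, mu1 (rho1 p) = mu2 (rho2 p);
  pullback_iso : let rho p := (rho1 p, rho2 p) in
    [/\ star_hom (rho : P -> (A * B)%type),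
        equivariant gP (dsum_action gA gB) rho &
        set_bij setT (fibre_product mu1 mu2) rho]
}.

Record digraph := Digraph {
  vtx : choiceType;
  edg : choiceType;
  src : edg -> vtx;
  rng : edg -> vtx
}.

Arguments src : simpl never.
Arguments rng : simpl never.

Definition out_edges (E : digraph) (v : vtx E) : set (edg E) :=
  [set e | src e = v].

Definition regular (E : digraph) : set (vtx E) :=
  [set v | out_edges v !=set0 /\ finite_set (out_edges v)].

Record relgraph := RelGraph {
  relgraph_graph :> digraph;
  marked : set (vtx relgraph_graph);
  marked_regular : marked `<=` @regular relgraph_graph
}.
Arguments marked : clear implicits.

Definition hereditary (E : digraph) (H : set (vtx E)) : Prop :=
  forall e : edg E, H (src e) -> H (rng e).

(* The inclusion of [F] in [E] is the pair [mvtx], [medg]; the subsets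
   of [F] become their images in [E]. *)
Record relmorph (F E : relgraph) := RelMorph {
  mvtx : vtx F -> vtx E;
  medg : edg F -> edg E;
  mvtx_inj : injective mvtx;
  medg_inj : injective medg;
  src_medg : forall e, src (medg e) = mvtx (src e);
  rng_medg : forall e, rng (medg e) = mvtx (rng e);
  relmorph_hereditary : hereditary (~` range mvtx);
  relmorph_full : range medg =
    [set e | range mvtx (src e) /\ range mvtx (rng e)];
  relmorph_marked : marked E `&` range mvtx `<=` mvtx @` marked F
}.

Section Glue.
Context {A B C : choiceType} (f : A -> B) (g : A -> C).

Definition glue_step (x y : B + C) : Prop :=
  exists a, x = inl (f a) /\ y = inr (g a).

Definition glue_rel (x y : B + C) : bool :=
  `[< clos_refl_sym_trans _ glue_step x y >].

Let glue_refl : reflexive glue_rel.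
Proof. by move=> x; apply/asboolP; exact: rst_refl. Qed.

Let glue_sym : ssrbool.symmetric glue_rel.
Proof.
by move=> x y; apply/idP/idP => /asboolP h; apply/asboolP; exact: rst_sym.
Qed.

Let glue_trans : ssrbool.transitive glue_rel.
Proof.
move=> y x z /asboolP xy /asboolP yz; apply/asboolP.
exact: (rst_trans _ _ _ y).
Qed.

Definition glue_equiv : equiv_rel (B + C)%type :=
  EquivRel glue_rel glue_refl glue_sym glue_trans.

Definition glue : choiceType := {eq_quot glue_equiv}.

Definition glue1 (x : B) : glue := \pi_{eq_quot glue_equiv} (inl x).
Definition glue2 (y : C) : glue := \pi_{eq_quot glue_equiv} (inr y).

Lemma glueP (q : glue) : (exists x, q = glue1 x) \/ (exists y, q = glue2 y).
Proof.
rewrite -[q](@reprK _ {eq_quot glue_equiv}).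
by case: (repr q) => [x|y]; [left; exists x|right; exists y].
Qed.

Lemma glue12 (a : A) : glue1 (f a) = glue2 (g a).
Proof.
apply/eqmodP; apply/asboolP; apply: rst_step; by exists a.
Qed.

Hypotheses (f_inj : injective f) (g_inj : injective g).

Let explicit (x y : B + C) : Prop :=
  match x, y with
  | inl b, inl b' => b = b'
  | inr c, inr c' => c = c'
  | inl b, inr c | inr c, inl b => exists a, b = f a /\ c = g a
  end.

Let glue_explicit x y : clos_refl_sym_trans _ glue_step x y -> explicit x y.
Proof.
elim=> {x y} [x y [a [-> ->]]|[]//|[x|x] [y|y]//|] /=; first by exists a.
move=> [x|x] [y|y] [z|z] _ /= xy _ yz.
- by rewrite xy.
- by rewrite xy.
- by case: xy yz => a [-> ->] [b [-> /g_inj->]].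
- by rewrite -yz.
- by rewrite -yz.
- by case: xy yz => a [-> ->] [b [/f_inj-> ->]].
- by rewrite xy.
- by rewrite xy.
Qed.

Lemma glue1_inj : injective glue1.
Proof. by move=> x y /eqmodP/asboolP/glue_explicit. Qed.

Lemma glue2_inj : injective glue2.
Proof. by move=> x y /eqmodP/asboolP/glue_explicit. Qed.

Lemma glue12P x y : glue1 x = glue2 y -> exists a, x = f a /\ y = g a.
Proof. by move=> /eqmodP/asboolP/glue_explicit. Qed.

End Glue.

Section GlueMap.
Context {A B C A' B' C' : choiceType}.
Context (f : A -> B) (g : A -> C) (f' : A' -> B') (g' : A' -> C').
Context (a : A -> A') (b : B -> B') (c : C -> C').

Definition glue_map (q : glue f g) : glue f' g' :=
  match repr (q : {eq_quot glue_equiv f g}) with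
  | inl x => glue1 f' g' (b x)
  | inr y => glue2 f' g' (c y)
  end.

Hypothesis bf : forall x, b (f x) = f' (a x).
Hypothesis cg : forall x, c (g x) = g' (a x).

Let on_sum (x : B + C) : glue f' g' :=
  match x with
  | inl x => glue1 f' g' (b x)
  | inr y => glue2 f' g' (c y)
  end.

Let on_sum_compat x y :
  clos_refl_sym_trans _ (glue_step f g) x y -> on_sum x = on_sum y.
Proof.
elim=> {x y} [x y [u [-> ->]]|//|//|x y z _ -> _ ->//] /=.
by rewrite bf cg glue12.
Qed.

Let glue_mapE x : glue_map (\pi_{eq_quot glue_equiv f g} x) = on_sum x.
Proof.
apply: on_sum_compat; apply/asboolP.
rewrite -/(glue_rel f g _ _) -[glue_rel f g]/(equiv (glue_equiv f g)).
by apply/eqmodP; rewrite reprK.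
Qed.

Lemma glue_map1 x : glue_map (glue1 f g x) = glue1 f' g' (b x).
Proof. exact: glue_mapE. Qed.

Lemma glue_map2 y : glue_map (glue2 f g y) = glue2 f' g' (c y).
Proof. exact: glue_mapE. Qed.

End GlueMap.

Section Pushout.
Context {F0 F1 F2 : relgraph} (a1 : relmorph F0 F1) (a2 : relmorph F0 F2).

Definition pushout_graph : digraph := {|
  vtx := glue (mvtx a1) (mvtx a2);
  edg := glue (medg a1) (medg a2);
  src := @glue_map _ _ _ _ _ _ (medg a1) (medg a2) (mvtx a1) (mvtx a2)
           (@src F1) (@src F2);
  rng := @glue_map _ _ _ _ _ _ (medg a1) (medg a2) (mvtx a1) (mvtx a2)
           (@rng F1) (@rng F2)
|}.

Definition pushout_vtx1 : vtx F1 -> vtx pushout_graph :=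
  glue1 (mvtx a1) (mvtx a2).
Definition pushout_vtx2 : vtx F2 -> vtx pushout_graph :=
  glue2 (mvtx a1) (mvtx a2).
Definition pushout_edg1 : edg F1 -> edg pushout_graph :=
  glue1 (medg a1) (medg a2).
Definition pushout_edg2 : edg F2 -> edg pushout_graph :=
  glue2 (medg a1) (medg a2).
Definition pushout_vtx0 : vtx F0 -> vtx pushout_graph :=
  pushout_vtx1 \o mvtx a1.

Definition pushout_marked : set (vtx pushout_graph) :=
  (pushout_vtx1 @` marked F1 `\` range pushout_vtx0) `|`
  (pushout_vtx2 @` marked F2 `\` range pushout_vtx0) `|`
  (pushout_vtx1 @` marked F1 `&` pushout_vtx2 @` marked F2).

Let v1_inj : injective pushout_vtx1.
Proof. exact: glue1_inj (@mvtx_inj _ _ a1) (@mvtx_inj _ _ a2). Qed.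
Let v2_inj : injective pushout_vtx2.
Proof. exact: glue2_inj (@mvtx_inj _ _ a1) (@mvtx_inj _ _ a2). Qed.
Let e1_inj : injective pushout_edg1.
Proof. exact: glue1_inj (@medg_inj _ _ a1) (@medg_inj _ _ a2). Qed.
Let e2_inj : injective pushout_edg2.
Proof. exact: glue2_inj (@medg_inj _ _ a1) (@medg_inj _ _ a2). Qed.

Let vP x y : pushout_vtx1 x = pushout_vtx2 y ->
  exists v, x = mvtx a1 v /\ y = mvtx a2 v.
Proof. by apply: glue12P; exact: mvtx_inj. Qed.

Let v12 v : pushout_vtx1 (mvtx a1 v) = pushout_vtx2 (mvtx a2 v).
Proof. exact: glue12. Qed.

Let e12 e : pushout_edg1 (medg a1 e) = pushout_edg2 (medg a2 e).
Proof. exact: glue12. Qed.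

Lemma src_pushout_edg1 e : src (pushout_edg1 e) = pushout_vtx1 (src e).
Proof. by apply: (glue_map1 (a := @src F0)) => x; rewrite src_medg. Qed.
Lemma src_pushout_edg2 e : src (pushout_edg2 e) = pushout_vtx2 (src e).
Proof. by apply: (glue_map2 (a := @src F0)) => x; rewrite src_medg. Qed.
Lemma rng_pushout_edg1 e : rng (pushout_edg1 e) = pushout_vtx1 (rng e).
Proof. by apply: (glue_map1 (a := @rng F0)) => x; rewrite rng_medg. Qed.
Lemma rng_pushout_edg2 e : rng (pushout_edg2 e) = pushout_vtx2 (rng e).
Proof. by apply: (glue_map2 (a := @rng F0)) => x; rewrite rng_medg. Qed.

Lemma pushout_edgP (e : edg pushout_graph) :
  (exists e1, e = pushout_edg1 e1) \/ (exists e2, e = pushout_edg2 e2).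
Proof. exact: glueP. Qed.

Lemma pushout_vtxP (v : vtx pushout_graph) :
  (exists v1, v = pushout_vtx1 v1) \/ (exists v2, v = pushout_vtx2 v2).
Proof. exact: glueP. Qed.

Let out1 v : out_edges (pushout_vtx1 v) `<=`
  pushout_edg1 @` out_edges v `|`
  pushout_edg2 @` [set e | pushout_vtx2 (src e) = pushout_vtx1 v].
Proof.
move=> e; have [[e' ->]|[e' ->]] := pushout_edgP e; rewrite /out_edges /=.
- by rewrite src_pushout_edg1 => /v1_inj <-; left; exists e'.
- by rewrite src_pushout_edg2 => h; right; exists e'.
Qed.

Let out2 v : out_edges (pushout_vtx2 v) `<=`
  pushout_edg2 @` out_edges v `|`
  pushout_edg1 @` [set e | pushout_vtx1 (src e) = pushout_vtx2 v].
Proof.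
move=> e; have [[e' ->]|[e' ->]] := pushout_edgP e; rewrite /out_edges /=.
- by rewrite src_pushout_edg1 => h; right; exists e'.
- by rewrite src_pushout_edg2 => /v2_inj <-; left; exists e'.
Qed.

Lemma pushout_marked_regular : pushout_marked `<=` @regular pushout_graph.
Proof.
move=> q [[]|].
- move=> [[v mv <-] nv0]; have [[e ev] fv] := marked_regular mv; split.
    exists (pushout_edg1 e); rewrite /out_edges /= src_pushout_edg1.
    by rewrite (ev : src e = v).
  apply: (sub_finite_set (@out1 v)); rewrite finite_setU; split.
    exact: finite_image.
  rewrite (_ : [set e | _] = set0) ?image_set0//.
  apply/seteqP; split=> // e' /= /esym/vP[w [vw _]].
  by apply: nv0; exists w => //; rewrite /pushout_vtx0 /= -vw.
- move=> [[v mv <-] nv0]; have [[e ev] fv] := marked_regular mv; split.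
    exists (pushout_edg2 e); rewrite /out_edges /= src_pushout_edg2.
    by rewrite (ev : src e = v).
  apply: (sub_finite_set (@out2 v)); rewrite finite_setU; split.
    exact: finite_image.
  rewrite (_ : [set e | _] = set0) ?image_set0//.
  apply/seteqP; split=> // e' /= /vP[w [_ vw]].
  by apply: nv0; exists w => //; rewrite /pushout_vtx0 /= v12 -vw.
- move=> [[v mv <-] [v' mv' vv']].
  have [[e ev] fv] := marked_regular mv.
  have [_ fv'] := marked_regular mv'; split.
    exists (pushout_edg1 e); rewrite /out_edges /= src_pushout_edg1.
    by rewrite (ev : src e = v).
  apply: (sub_finite_set (@out1 v)); rewrite finite_setU; split.
    exact: finite_image.
  apply: finite_image; apply: sub_finite_set fv' => e' /=.
  by rewrite -vv' => /v2_inj.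
Qed.

Definition pushout : relgraph := RelGraph pushout_marked_regular.

Let hered1 : hereditary (~` range pushout_vtx1).
Proof.
move=> e; have [[e' ->]|[e' ->]] := pushout_edgP e.
  by rewrite src_pushout_edg1 => ns; exfalso; apply: ns; exists (src e').
rewrite src_pushout_edg2 rng_pushout_edg2 => ns [v _ /vP[w [_ rw]]].
have h : (~` range (mvtx a2)) (src e').
  by move=> [u _ us]; apply: ns; exists (mvtx a1 u); rewrite // v12 us.
by apply: (relmorph_hereditary h); exists w.
Qed.

Let hered2 : hereditary (~` range pushout_vtx2).
Proof.
move=> e; have [[e' ->]|[e' ->]] := pushout_edgP e; last first.
  by rewrite src_pushout_edg2 => ns; exfalso; apply: ns; exists (src e').
rewrite src_pushout_edg1 rng_pushout_edg1 => ns [v _ /esym/vP[w [rw _]]].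
have h : (~` range (mvtx a1)) (src e').
  by move=> [u _ us]; apply: ns; exists (mvtx a2 u); rewrite // -v12 us.
by apply: (relmorph_hereditary h); exists w.
Qed.

Let full1 : range pushout_edg1 = [set e | range pushout_vtx1 (src e) /\
  range pushout_vtx1 (rng e)].
Proof.
apply/seteqP; split=> [_ [e _ <-]|e] /=.
  rewrite src_pushout_edg1 rng_pushout_edg1.
  by split; [exists (src e)|exists (rng e)].
have [[e' ->] _|[e' ->]] := pushout_edgP e; first by exists e'.
rewrite src_pushout_edg2 rng_pushout_edg2.
move=> [[x _ /vP[v [_ sv]]] [y _ /vP[w [_ rw]]]].
have : range (medg a2) e'.
  by rewrite relmorph_full /= sv rw; split; [exists v|exists w].
by move=> [e0 _ <-]; exists (medg a1 e0); rewrite // e12.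
Qed.

Let full2 : range pushout_edg2 = [set e | range pushout_vtx2 (src e) /\
  range pushout_vtx2 (rng e)].
Proof.
apply/seteqP; split=> [_ [e _ <-]|e] /=.
  rewrite src_pushout_edg2 rng_pushout_edg2.
  by split; [exists (src e)|exists (rng e)].
have [[e' ->]|[e' ->] _] := pushout_edgP e; last by exists e'.
rewrite src_pushout_edg1 rng_pushout_edg1.
move=> [[x _ /esym/vP[v [sv _]]] [y _ /esym/vP[w [rw _]]]].
have : range (medg a1) e'.
  by rewrite relmorph_full /= sv rw; split; [exists v|exists w].
by move=> [e0 _ <-]; exists (medg a2 e0); rewrite // e12.
Qed.

Let marked1 : pushout_marked `&` range pushout_vtx1 `<=`
  pushout_vtx1 @` marked F1.
Proof.
move=> q [mq [v _ vq]]; case: mq => [[[]//|[[v' _ v'q] n0]]|[]//].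
exfalso; apply: n0; have [w [vw _]] := vP (etrans vq (esym v'q)).
by exists w; rewrite // /pushout_vtx0 /= -vw.
Qed.

Let marked2 : pushout_marked `&` range pushout_vtx2 `<=`
  pushout_vtx2 @` marked F2.
Proof.
move=> q [mq [v _ vq]]; case: mq => [[[[v' _ v'q] n0]|[]//]|[]//].
exfalso; apply: n0; have [w [vw _]] := vP (etrans v'q (esym vq)).
by exists w; rewrite // /pushout_vtx0 /= -vw.
Qed.

Definition pushout_in1 : relmorph F1 pushout := {|
  mvtx := pushout_vtx1 : vtx F1 -> vtx pushout;
  medg := pushout_edg1;
  mvtx_inj := v1_inj; medg_inj := e1_inj;
  src_medg := src_pushout_edg1; rng_medg := rng_pushout_edg1;
  relmorph_hereditary := hered1; relmorph_full := full1;
  relmorph_marked := marked1 |}.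

Definition pushout_in2 : relmorph F2 pushout := {|
  mvtx := pushout_vtx2 : vtx F2 -> vtx pushout;
  medg := pushout_edg2;
  mvtx_inj := v2_inj; medg_inj := e2_inj;
  src_medg := src_pushout_edg2; rng_medg := rng_pushout_edg2;
  relmorph_hereditary := hered2; relmorph_full := full2;
  relmorph_marked := marked2 |}.

(* [A0 `<=` A1 `|` A2] as subsets of the pushout: since [A0] lies in [F0], the
   sets [A1] and [A2] may be pulled back to [F0]. *)
Definition admissible : Prop :=
  marked F0 `<=` (mvtx a1 @^-1` marked F1) `|` (mvtx a2 @^-1` marked F2).

End Pushout.

Section CKFamily.
Context {R : realType} {B : cstarAlgType R}.

Definition projection (p : B) : Prop := cstar p = p /\ cmul p p = p.

(* [q <= p] in the usual order of projections. *)
Definition projection_le (q p : B) : Prop := cmul p q = q.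

Record ck_family (E : relgraph) (p : vtx E -> B) (s : edg E -> B) : Prop := {
  ck_projection : forall v, projection (p v);
  ck_orthogonal : forall v w, v <> w -> cmul (p v) (p w) = 0;
  ck_partial_isometry : forall e, cmul (cmul (s e) (cstar (s e))) (s e) = s e;
  ck_ranges : forall e f, e <> f ->
    cmul (cmul (s e) (cstar (s e))) (cmul (s f) (cstar (s f))) = 0;
  ck_source : forall e, cmul (cstar (s e)) (s e) = p (rng e);
  ck_le : forall e, projection_le (cmul (s e) (cstar (s e))) (p (src e));
  ck_sum : forall v, marked E v ->
    p v = \sum_(e \in out_edges v) cmul (s e) (cstar (s e))
}.

End CKFamily.

Record closed_star_subalgebra (R : realType) (A : cstarAlgType R)
    (S : set A) : Prop := {
  subalgebra0 : S 0;
  subalgebraD : forall x y, S x -> S y -> S (x + y);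
  subalgebraZ : forall (a : R[i]) x, S x -> S (a *: x);
  subalgebraM : forall x y, S x -> S y -> S (cmul x y);
  subalgebra_star : forall x, S x -> S (cstar x);
  subalgebra_closed : closed S
}.

(* The universal C*-algebra [C^*(E, R)], determined up to isomorphism: it is
   generated by a family satisfying the relations of [(E, R)], and every such
   family in a C*-algebra is the image of the generators under some
   *-homomorphism, necessarily unique since the generators generate. *)
Record relgraph_calg (R : realType) (E : relgraph) := RelGraphCAlg {
  calg :> cstarAlgType R;
  calg_p : vtx E -> calg;
  calg_s : edg E -> calg;
  calg_family : ck_family calg_p calg_s;
  calg_generated : forall S : set calg, closed_star_subalgebra S ->
    range calg_p `<=` S -> range calg_s `<=` S -> S = setT;
  calg_universal : forall (B : cstarAlgType R) (p : vtx E -> B)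
      (s : edg E -> B), ck_family p s ->
    exists f : calg -> B, [/\ star_hom f, (forall v, f (calg_p v) = p v) &
      forall e, f (calg_s e) = s e]
}.

Section UniversalMap.
Context {R : realType} {E : relgraph} (U : relgraph_calg R E).
Context {B : cstarAlgType R} {p : vtx E -> B} {s : edg E -> B}.
Hypothesis family : ck_family p s.

Definition universal_map : U -> B := sval (cid (calg_universal U family)).

Lemma universal_map_hom : star_hom universal_map.
Proof. by rewrite /universal_map; case: cid => f []. Qed.

Lemma universal_map_p v : universal_map (calg_p U v) = p v.
Proof. by rewrite /universal_map; case: cid => f []. Qed.

Lemma universal_map_s e : universal_map (calg_s U e) = s e.
Proof. by rewrite /universal_map; case: cid => f []. Qed.

End UniversalMap.
Arguments universal_map {R E} U {B p s} family _.

Section Gauge.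
Context {R : realType} {E : relgraph} (U : relgraph_calg R E).

Lemma gauge_family (z : unit_circle R) :
  ck_family (calg_p U) (fun e => (val z : R[i]) *: calg_s U e).
Proof.
have z1 : (val z : R[i]) * (val z : R[i])^* = 1.
  have := valP z; rewrite inE /unit_circle /= => nz.
  by rewrite -normCK nz expr1n.
have zz e : cmul ((val z : R[i]) *: calg_s U e)
    (cstar ((val z : R[i]) *: calg_s U e)) =
    cmul (calg_s U e) (cstar (calg_s U e)).
  by rewrite cstarZ cmulZl cmulZr scalerA z1 scale1r.
have [h1 h2 h3 h4 h5 h6 h7] := calg_family U; split => //.
- by move=> e; rewrite zz cmulZr h3.
- by move=> e f ef; rewrite !zz h4.
- by move=> e; rewrite cstarZ cmulZl cmulZr scalerA mulrC z1 scale1r h5.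
- by move=> e; rewrite zz; exact: h6.
- by move=> v mv; rewrite h7//; apply: eq_fsbigr => e _; rewrite zz.
Qed.

Definition gauge (z : unit_circle R) : U -> U :=
  universal_map U (gauge_family z).

End Gauge.
Arguments gauge {R E} U z _.

(* Extension by [0] of a function on [X] along the inclusion [i : X -> Y]. *)
Definition extend0 (X Y : Type) (V : zmodType) (i : X -> Y) (f : X -> V)
    (y : Y) : V :=
  if pselect (exists x, i x = y) is left xP then f (sval (cid xP)) else 0.

Lemma extend0E (X Y : Type) (V : zmodType) (i : X -> Y) (f : X -> V) x :
  injective i -> extend0 i f (i x) = f x.
Proof.
move=> ii; rewrite /extend0; case: pselect => [h|]; last by case; exists x.
by case: cid => x' /= /ii ->.
Qed.

Lemma extend0_out (X Y : Type) (V : zmodType) (i : X -> Y) (f : X -> V) y :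
  ~ range i y -> extend0 i f y = 0.
Proof.
move=> ny; rewrite /extend0; case: pselect => // -[x xy].
by exfalso; apply: ny; exists x.
Qed.

Section CanonicalSurjection.
Context {R : realType} {F E : relgraph} (a : relmorph F E).
Context (UE : relgraph_calg R E) (UF : relgraph_calg R F).

Definition canonical_p : vtx E -> UF := extend0 (mvtx a) (calg_p UF).
Definition canonical_s : edg E -> UF := extend0 (medg a) (calg_s UF).
Local Notation p := canonical_p.
Local Notation s := canonical_s.

Let pE v : p (mvtx a v) = calg_p UF v.
Proof. by apply: extend0E; exact: mvtx_inj. Qed.

Let sE e : s (medg a e) = calg_s UF e.
Proof. by apply: extend0E; exact: medg_inj. Qed.

Let vtx_dec v : (exists v', v = mvtx a v') \/
  ~ range (mvtx a) v /\ p v = 0.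
Proof.
have [[v' _ <-]|nv] := pselect (range (mvtx a) v); first by left; exists v'.
by right; split => //; exact: extend0_out.
Qed.

Let edg_dec e : (exists e', e = medg a e') \/
  ~ range (medg a) e /\ s e = 0.
Proof.
have [[e' _ <-]|ne] := pselect (range (medg a) e); first by left; exists e'.
by right; split => //; exact: extend0_out.
Qed.

Lemma canonical_family : ck_family p s.
Proof.
have [h1 h2 h3 h4 h5 h6 h7] := calg_family UF; split.
- move=> v; have [[v' ->]|[_ ->]] := vtx_dec v; first by rewrite pE.
  by split; rewrite ?cstar0 ?cmul0x.
- move=> v w; have [[v' ->]|[_ ->]] := vtx_dec v; last by rewrite cmul0x.
  have [[w' ->]|[_ ->]] := vtx_dec w; last by rewrite cmulx0.
  by move=> vw; rewrite !pE h2// => vw'; apply: vw; rewrite vw'.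
- move=> e; have [[e' ->]|[_ ->]] := edg_dec e; first by rewrite sE.
  by rewrite !cmul0x.
- move=> e f; have [[e' ->]|[_ ->]] := edg_dec e; last by rewrite !cmul0x.
  have [[f' ->]|[_ ->]] := edg_dec f; last by rewrite cmul0x cmulx0.
  by move=> ef; rewrite !sE h4// => ef'; apply: ef; rewrite ef'.
- move=> e; have [[e' ->]|[ne ->]] := edg_dec e.
    by rewrite sE rng_medg pE h5.
  rewrite cmulx0 /canonical_p extend0_out// => re; apply: ne.
  rewrite relmorph_full; split => //; apply: contrapT => ns.
  exact: (relmorph_hereditary ns).
- move=> e; have [[e' ->]|[ne ->]] := edg_dec e.
    by rewrite sE src_medg pE; exact: h6.
  by rewrite /projection_le cmul0x cmulx0.
- move=> v mv; have [[v' vv']|[nv ->]] := vtx_dec v; last first.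
    rewrite fsbig1// => e ev; have [[e' ee']|[_ ->]] := edg_dec e.
      by exfalso; apply: nv; exists (src e'); rewrite // -ev ee' src_medg.
    by rewrite cmul0x.
  have mv' : marked F v'.
    have [] := @relmorph_marked _ _ a v; first by split => //; exists v'.
    by move=> w mw; rewrite vv' => /mvtx_inj <-.
  rewrite vv' pE h7//.
  rewrite (_ : \sum_(e \in out_edges v') _ =
    \sum_(e \in out_edges v') cmul (s (medg a e)) (cstar (s (medg a e)))).
    rewrite -(fsbig_image _ (medg a)
      (fun e => cmul (s e) (cstar (s e)))); last first.
      by move=> x y _ _; exact: medg_inj.
    apply: fsbig_widen => e /=.
      by move=> [e' ev' <-]; rewrite /out_edges /= src_medg ev'.
    move=> [ev ne]; have [[e' ee']|[_ ->]] := edg_dec e.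
      exfalso; apply: ne; exists e' => //.
      apply: (@mvtx_inj _ _ a); rewrite -src_medg -ee'; exact: ev.
    by rewrite cmul0x.
  by apply: eq_fsbigr => e _; rewrite sE.
Qed.

Definition canonical_surjection : UE -> UF :=
  universal_map UE canonical_family.

Lemma canonical_surjection_p v :
  canonical_surjection (calg_p UE (mvtx a v)) = calg_p UF v.
Proof. by rewrite /canonical_surjection universal_map_p. Qed.

Lemma canonical_surjection_s e :
  canonical_surjection (calg_s UE (medg a e)) = calg_s UF e.
Proof. by rewrite /canonical_surjection universal_map_s. Qed.

Lemma canonical_surjection_p_out v : ~ range (mvtx a) v ->
  canonical_surjection (calg_p UE v) = 0.
Proof.
move=> nv; rewrite /canonical_surjection universal_map_p.
exact: extend0_out.
Qed.

Lemma canonical_surjection_s_out e : ~ range (medg a) e ->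
  canonical_surjection (calg_s UE e) = 0.
Proof.
move=> ne; rewrite /canonical_surjection universal_map_s.
exact: extend0_out.
Qed.

End CanonicalSurjection.
Arguments canonical_surjection {R F E} a UE UF _.

(* Main.v *)
Require Import Defs.
From HB Require Import structures.
From mathcomp Require Import all_boot all_order all_algebra.
From mathcomp Require Import generic_quotient ring_quotient complex ring lra.
From mathcomp Require Import all_classical all_reals all_analysis.
Set Implicit Arguments.
Unset Strict Implicit.
Unset Printing Implicit Defensive.
Import Order.TTheory GRing.Theory Num.Theory.
Import numFieldNormedType.Exports.
Local Open Scope classical_set_scope.
Local Open Scope ring_scope.
Local Open Scope complex_scope.

(** Write [J1], [J2] for the kernels of the two surjections out of [C^*(E, A)].
    A kernel of a canonical surjection is the closed ideal spanned by the vertex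
    projections that are sent to [0] and by the gap projections
    [p_v - \sum s_e s_e^*] of the newly marked vertices: the quotient by that
    ideal is a C*-algebra carrying a family for the smaller relative graph, so
    universality gives an inverse. In the pushout the generators [q1] of [J1]
      and
    [q2] of [J2] satisfy [q1 s_mu s_nu^* q2 = 0], hence [J1 J2 = 0]. Therefore
    [J1] and [J2] meet in [0], which is injectivity, and the first surjection is
    isometric on [J2]. The image of [J2] is then a closed ideal; admissibility
    puts the generators of the kernel of [C^*(F1, A1) -> C^*(F0, A0)] in it,
    which gives surjectivity.

    The C*-theory rests on one remark: if [b], [s] are commuting self-adjoint
    elements with [b^2 + (1 - s)^2 = 1], then [b + i (1 - s)] is unitary, so
    multiplication by [b] and by [1 - s] is contractive. With square roots
    obtained from a contraction this shows that *-homomorphisms are contractive,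
    and with [b = 2 v / (1 + v^2)] it yields the approximate units needed for
      the
    C*-identity in a quotient. *)

(** * The real-valued norm *)

Section RealComplex.
Context {R : realType}.
Implicit Types (t : R) (z : R[i]).

Lemma ltc0R t : (0 < t%:C) = (0 < t).
Proof. by rewrite -(rmorph0 (real_complex R)) ltcR. Qed.

Lemma lec0R t : (0 <= t%:C) = (0 <= t).
Proof. by rewrite -(rmorph0 (real_complex R)) lecR. Qed.

Lemma gt0_realE z : 0 < z -> z = (complex.Re z)%:C.
Proof. by move=> z0; rewrite RRe_real// gtr0_real. Qed.

Lemma exp_small (r K e : R) : 0 <= r -> r < 1 -> 0 < e ->
  exists N, forall n, (N <= n)%N -> K * r ^+ n < e.
Proof.
move=> r0 r1 e0.
have : K * r ^+ n @[n --> \oo] --> (0 : R).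
  rewrite -(mulr0 K); apply: cvgMr; apply: cvg_expr.
  by rewrite ger0_norm.
move=> /cvgrPdist_lt/(_ _ e0)[N _ Ne]; exists N => n Nn.
by have := Ne n Nn; rewrite /= sub0r normrN; apply: le_lt_trans;
  rewrite ler_norm.
Qed.

Lemma eps_le (a b : R) : (forall e, 0 < e -> a <= b + e) -> a <= b.
Proof. by move=> ab; apply/ler_addgt0Pr. Qed.

End RealComplex.

Section RealNorm.
Context {R : realType} {V : normedModType R[i]}.
Implicit Types (x y z : V) (S : set V).

(** The library norm takes values in [R[i]]. Its real part lives in an ordered field where infima,
    [lra] and [nra] are available. *)
Definition rnorm x : R := complex.Re `|x|.

Lemma rnormE x : `|x| = (rnorm x)%:C.
Proof. by rewrite /rnorm RRe_real// ger0_real. Qed.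

Lemma rnorm_ge0 x : 0 <= rnorm x.
Proof. by rewrite -lec0R -rnormE. Qed.

Lemma rnormD x y : rnorm (x + y) <= rnorm x + rnorm y.
Proof. by rewrite -lecR rmorphD/= -!rnormE ler_normD. Qed.

Lemma rnormN x : rnorm (- x) = rnorm x.
Proof. by rewrite /rnorm normrN. Qed.

Lemma rnormBC x y : rnorm (x - y) = rnorm (y - x).
Proof. by rewrite -rnormN opprB. Qed.

Lemma rnorm0 : rnorm 0 = 0.
Proof. by rewrite /rnorm normr0. Qed.

Lemma rnorm0_eq0 x : rnorm x = 0 -> x = 0.
Proof. by move=> x0; apply: normr0_eq0; rewrite rnormE x0. Qed.

Lemma rnormZ (a : R[i]) x : rnorm (a *: x) = complex.Re `|a| * rnorm x.
Proof.
by rewrite {1}/rnorm normrZ rnormE -{1}[`|a|]RRe_real ?ger0_real// -rmorphM.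
Qed.

Lemma rnormZr (t : R) x : rnorm (t%:C *: x) = `|t| * rnorm x.
Proof. by rewrite rnormZ normc_def/= expr0n addr0 sqrtr_sqr. Qed.

Lemma rnormZi x : rnorm ('i *: x) = rnorm x.
Proof. by rewrite rnormZ normc_def/= expr0n add0r expr1n sqrtr1 mul1r. Qed.

Lemma rnormB_triangle y x z : rnorm (x - z) <= rnorm (x - y) + rnorm (y - z).
Proof. by rewrite -[x - z](subrKA y) rnormD. Qed.

Lemma nbhs_rnormP x (P : set V) :
  nbhs x P <-> exists2 e : R, 0 < e & forall y, rnorm (x - y) < e -> P y.
Proof.
split=> [/nbhs_normP[e/= e0 eP]|[e e0 eP]].
  have eE : e = (complex.Re e)%:C by rewrite RRe_real// gtr0_real.
  exists (complex.Re e); first by rewrite -ltc0R -eE.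
  by move=> y xy; apply: eP; rewrite /= eE rnormE ltcR.
apply/nbhs_normP; exists e%:C; first by rewrite /= ltc0R.
by move=> y /=; rewrite rnormE ltcR; exact: eP.
Qed.

Lemma closed_rnormP S : closed S <->
  forall x, (forall e : R, 0 < e -> exists2 y, S y & rnorm (x - y) < e) -> S x.
Proof.
split=> clS x Sx.
  apply: clS => P /nbhs_rnormP[e e0 eP].
  by have [y Sy xy] := Sx _ e0; exists y; split => //; exact: eP.
apply: clS => e e0; have /Sx[y [Sy xy]] : nbhs x [set y | rnorm (x - y) < e].
  by apply/nbhs_rnormP; exists e.
by exists y.
Qed.

Lemma rnorm_eps0 x : (forall e, 0 < e -> rnorm x <= e) -> x = 0.
Proof.
move=> x0; apply: rnorm0_eq0; apply/eqP; rewrite eq_le rnorm_ge0 andbT.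
by apply: eps_le => e e0; rewrite add0r x0.
Qed.

End RealNorm.

(** * Convergence and fixed points in complete spaces *)

Section Complete.
Context {R : realType} {V : completeNormedModType R[i]}.

Lemma rnorm_cauchy_cvg (u : nat -> V) :
  (forall e : R, 0 < e -> exists N, forall n, (N <= n)%N ->
     rnorm (u N - u n) < e) ->
  exists l, forall e : R, 0 < e ->
    exists N, forall n, (N <= n)%N -> rnorm (u n - l) < e.
Proof.
move=> cu; have /cauchy_cvg/cvg_ex[l ul] : cauchy (u @ \oo).
  apply: cauchy_exP => e e0; rewrite (gt0_realE e0).
  have [|N Nu] := cu (complex.Re e); first by rewrite -ltc0R -gt0_realE.
  exists (u N), N => // n Nn /=.
  by rewrite -ball_normE /= rnormE ltcR Nu.
exists l => e e0.
have /ul[N _ Nl] : nbhs l [set y | rnorm (l - y) < e].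
  by apply/nbhs_rnormP; exists e.
by exists N => n Nn; rewrite rnormBC; exact: (Nl n Nn).
Qed.

Lemma geometric_cvg (u : nat -> V) (K r : R) : 0 <= r -> r < 1 ->
  (forall n, rnorm (u n.+1 - u n) <= K * r ^+ n) ->
  exists l, forall e : R, 0 < e ->
    exists N, forall n, (N <= n)%N -> rnorm (u n - l) < e.
Proof.
move=> r0 r1 uK; apply: rnorm_cauchy_cvg => e e0.
have K0 : 0 <= K.
  by apply: le_trans (rnorm_ge0 (u 1%N - u 0%N)) _;
    rewrite (le_trans (uK 0%N))// mulr1.
(* With [K = L (1 - r)] each increment is bounded by [L (r^n - r^(n+1))], so the bounds
   telescope. *)
pose L := K / (1 - r).
have L0 : 0 <= L by rewrite divr_ge0// subr_ge0 ltW.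
have uL n k : rnorm (u (n + k)%N - u n) <= L * (r ^+ n - r ^+ (n + k)).
  elim: k => [|k IHk]; first by rewrite addn0 !subrr rnorm0 mulr0.
  apply: le_trans (rnormB_triangle (u (n + k)%N) _ _) _.
  rewrite addnS (le_trans (lerD (uK _) IHk))//.
  have -> : K = L * (1 - r) by rewrite divfK// subr_eq0 gt_eqF.
  by rewrite exprS le_eqVlt; apply/orP; left; apply/eqP; ring.
have [N Ne] := exp_small L r0 r1 e0; exists N => n Nn.
rewrite rnormBC -(subnKC Nn); apply: le_lt_trans (uL _ _) _.
apply: le_lt_trans (Ne N (leqnn N)); rewrite ler_wpM2l// gerBl.
by rewrite exprn_ge0.
Qed.

(** Banach's theorem on a closed invariant set. In the applications [S] records self-adjointness,
    commutation, a norm bound or membership in an ideal, and the fixed point inherits these. *)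
Lemma contraction_fixpoint (S : set V) (f : V -> V) (x0 : V) (r : R) :
  closed S -> S x0 -> (forall x, S x -> S (f x)) -> 0 <= r -> r < 1 ->
  (forall x y, S x -> S y -> rnorm (f x - f y) <= r * rnorm (x - y)) ->
  exists2 x, S x & f x = x.
Proof.
move=> clS Sx0 Sf r0 r1 fr; pose u n := iter n f x0.
have Su n : S (u n) by elim: n => //= n; exact: Sf.
have ur n : rnorm (u n.+1 - u n) <= rnorm (u 1%N - u 0%N) * r ^+ n.
  elim: n => [|n IHn]; first by rewrite mulr1.
  apply: (le_trans (fr _ _ (Su n.+1) (Su n))).
  by rewrite exprS mulrCA ler_wpM2l.
have [l ul] := geometric_cvg r0 r1 ur.
have Sl : S l.
  move/closed_rnormP: clS; apply => e e0.
  by have [N Ne] := ul _ e0; exists (u N) => //; rewrite rnormBC Ne.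
exists l => //; apply/eqP; rewrite -subr_eq0; apply/eqP;
  apply: rnorm_eps0 => e e0.
have e20 : 0 < e / 2 by rewrite divr_gt0.
have [N Ne] := ul _ e20.
apply: le_trans (rnormB_triangle (u N.+1) _ _) _.
rewrite [e]splitr lerD//; last by rewrite ltW// Ne.
apply: (le_trans (fr _ _ Sl (Su N))).
rewrite rnormBC; apply: le_trans (ltW (Ne N (leqnn N))).
by rewrite ler_piMl ?rnorm_ge0// ltW.
Qed.

End Complete.

(** * Contractivity of *-homomorphisms *)

Section Lipschitz.
Context {R : realType}.
Implicit Types U V W : normedModType R[i].

(** The form in which continuity is used: such maps are stable under composition and linear
    combination, include the involution and multiplication by a fixed element, and pull closed sets
    back to closed sets. *)
Definition lipschitz_map U V (f : U -> V) : Prop :=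
  exists2 K : R, 0 <= K & forall x y, rnorm (f x - f y) <= K * rnorm (x - y).

Lemma lipschitz_map_id U : lipschitz_map (fun x : U => x).
Proof. by exists 1 => // x y; rewrite mul1r. Qed.

Lemma lipschitz_map_comp U V W (f : V -> W) (g : U -> V) :
  lipschitz_map f -> lipschitz_map g -> lipschitz_map (fun x => f (g x)).
Proof.
move=> [K K0 fK] [L L0 gL]; exists (K * L) => [|x y]; first exact: mulr_ge0.
by rewrite (le_trans (fK _ _))// -mulrA ler_wpM2l.
Qed.

Lemma lipschitz_mapD U V (f g : U -> V) :
  lipschitz_map f -> lipschitz_map g -> lipschitz_map (fun x => f x + g x).
Proof.
move=> [K K0 fK] [L L0 gL]; exists (K + L) => [|x y]; first exact: addr_ge0.
by rewrite opprD addrACA (le_trans (rnormD _ _))// mulrDl lerD.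
Qed.

Lemma lipschitz_mapZ U V (a : R[i]) (f : U -> V) :
  lipschitz_map f -> lipschitz_map (fun x => a *: f x).
Proof.
have a0 : 0 <= complex.Re `|a| by rewrite -lec0R RRe_real// ger0_real.
move=> [K K0 fK]; exists (complex.Re `|a| * K) => [|x y]; first exact: mulr_ge0.
by rewrite -scalerBr rnormZ -mulrA ler_wpM2l.
Qed.

Lemma lipschitz_mapB U V (f g : U -> V) :
  lipschitz_map f -> lipschitz_map g -> lipschitz_map (fun x => f x - g x).
Proof.
move=> lf lg; apply: lipschitz_mapD => //.
under [X in lipschitz_map X]funext do rewrite -scaleN1r.
exact: lipschitz_mapZ.
Qed.

Lemma closed_lipschitz_preimage U V (f : U -> V) (S : set V) :
  lipschitz_map f -> closed S -> closed [set x | S (f x)].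
Proof.
move=> [K K0 fK] /closed_rnormP clS; apply/closed_rnormP => x Sx.
(* Dividing by [K + 1] covers the case [K = 0]. *)
apply: clS => e e0; have K1 : 0 < K + 1 by rewrite ltr_wpDl.
have [|y Sy xy] := Sx (e / (K + 1)); first by rewrite divr_gt0.
exists (f y) => //; apply: le_lt_trans (fK _ _) _.
rewrite ltr_pdivlMr// in xy; apply: le_lt_trans xy.
by rewrite mulrC ler_wpM2l ?rnorm_ge0// lerDl.
Qed.

Lemma closed_singleton0 U : closed [set x : U | x = 0].
Proof.
apply/closed_rnormP => x x0; apply: rnorm_eps0 => e e0.
by have [y -> ] := x0 e e0; rewrite subr0 => /ltW.
Qed.

Lemma closed_lipschitz_eq U V (f g : U -> V) :
  lipschitz_map f -> lipschitz_map g -> closed [set x | f x = g x].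
Proof.
move=> lf lg; rewrite (_ : [set x | _] = [set x | f x - g x = 0]).
  exact: closed_lipschitz_preimage (lipschitz_mapB lf lg) (@closed_singleton0
    V).
by apply/seteqP; split=> x /=; [move=> ->; rewrite subrr|move/subr0_eq].
Qed.

Lemma closed_rnorm_le U (r : R) : closed [set x : U | rnorm x <= r].
Proof.
apply/closed_rnormP => x xr; apply: eps_le => e e0.
have [y yr /ltW xy] := xr e e0.
by rewrite -[x](subrK y) addrC (le_trans (rnormD _ _))// lerD.
Qed.

Lemma closed_and U (S T : set U) :
  closed S -> closed T -> closed [set x | S x /\ T x].
Proof. exact: closedI. Qed.

Lemma closed_forall U I (S : I -> set U) :
  (forall i, closed (S i)) -> closed [set x | forall i, S i x].
Proof.
move=> cS; rewrite (_ : [set x | _] = \bigcap_i S i); first exact: closed_bigI.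
by apply/seteqP; split => x Sx i; [move=> _; exact: Sx|exact: Sx].
Qed.

End Lipschitz.

(** * Norm estimates from the C*-identity, and square roots *)

Section CStarBasics.
Context {R : realType} {A : cstarAlgType R}.
Implicit Types x y z : A.
Local Notation "x ** y" := (cmul x y) (at level 40, left associativity).

Lemma cmulNl x y : (- x) ** y = - (x ** y).
Proof. by rewrite -scaleN1r cmulZl scaleN1r. Qed.

Lemma cmulNr x y : x ** (- y) = - (x ** y).
Proof. by rewrite -scaleN1r cmulZr scaleN1r. Qed.

Lemma cmulBl x y z : (x - y) ** z = x ** z - y ** z.
Proof. by rewrite cmulDl cmulNl. Qed.

Lemma cmulBr x y z : x ** (y - z) = x ** y - x ** z.
Proof. by rewrite cmulDr cmulNr. Qed.

Lemma cstarN x : cstar (- x) = - cstar x.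
Proof. by rewrite -scaleN1r cstarZ rmorphN1 scaleN1r. Qed.

Lemma cstarB x y : cstar (x - y) = cstar x - cstar y.
Proof. by rewrite cstarD cstarN. Qed.

Lemma cstarZr (t : R) x : cstar (t%:C *: x) = t%:C *: cstar x.
Proof. by rewrite cstarZ [Num.conj _]conjc_real. Qed.

Lemma rnormM x y : rnorm (x ** y) <= rnorm x * rnorm y.
Proof. by rewrite -lecR rmorphM/= -!rnormE cnormM. Qed.

Lemma rnormMstar x : rnorm (cstar x ** x) = rnorm x ^+ 2.
Proof. by apply: complexI; rewrite rmorphXn/= -!rnormE cnorm_star. Qed.

(** The C*-identity gives [|y|^2 = |y^* y| <= |y^*| |y|]; cancel [|y|], then exchange [y] and its
    adjoint. *)
Lemma rnorm_star x : rnorm (cstar x) = rnorm x.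
Proof.
suff le y : rnorm y <= rnorm (cstar y).
  by apply/eqP; rewrite eq_le le andbT -{2}(cstarK x) le.
have [->|y0] := eqVneq (rnorm y) 0; first exact: rnorm_ge0.
have yp : 0 < rnorm y by rewrite lt_def y0 rnorm_ge0.
by rewrite -(ler_pM2r yp) -expr2 -rnormMstar rnormM.
Qed.

Lemma cstarM_eq0 x : cstar x ** x = 0 -> x = 0.
Proof.
move=> x0; apply: rnorm0_eq0; apply/eqP.
by rewrite -sqrf_eq0 -rnormMstar x0 rnorm0.
Qed.

Lemma lipschitz_mull x : lipschitz_map (fun y => x ** y).
Proof.
exists (rnorm x) => [|y z]; first exact: rnorm_ge0.
by rewrite -cmulBr rnormM.
Qed.

Lemma lipschitz_mulr x : lipschitz_map (fun y => y ** x).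
Proof.
exists (rnorm x) => [|y z]; first exact: rnorm_ge0.
by rewrite -cmulBl mulrC rnormM.
Qed.

Lemma lipschitz_star : lipschitz_map (@cstar R A).
Proof. by exists 1 => // x y; rewrite -cstarB rnorm_star mul1r. Qed.

Lemma scale_half x : (2^-1)%:C *: (x + x) = x.
Proof.
rewrite scalerDr -scalerDl -rmorphD/= (_ : 2^-1 + 2^-1 = 1) ?scale1r//.
by field.
Qed.

Lemma scale_half_add x : (2^-1)%:C *: x + (2^-1)%:C *: x = x.
Proof. by rewrite -scalerDr scale_half. Qed.

Lemma rnorm_average x y r : rnorm x = r -> rnorm y = r ->
  rnorm ((2^-1)%:C *: (x + y)) <= r.
Proof.
move=> xr yr; rewrite rnormZr ger0_norm ?invr_ge0// ler_pdivrMl//.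
by rewrite (le_trans (rnormD _ _))// xr yr mulr2n mulrDl mul1r.
Qed.

(* [p + i q] and [p - i q] both have the norm of [y]. *)
Lemma rnorm_le_of_squares y p q :
  cstar p ** q = cstar q ** p ->
  cstar p ** p + cstar q ** q = cstar y ** y ->
  rnorm p <= rnorm y /\ rnorm q <= rnorm y.
Proof.
move=> pq ppqq.
(* Here [c] is [i] or [-i]. The cross terms of the square of [p + c q] cancel because
   [p^* q = q^* p]. *)
have key (c : R[i]) : c * c = -1 -> Num.conj c = - c ->
  rnorm (p + c *: q) = rnorm y.
  move=> cc1 cN; apply/eqP; rewrite -(eqrXn2 (n := 2))// ?rnorm_ge0//.
  rewrite -!rnormMstar -ppqq cstarD cstarZ cN cmulDl !cmulDr !cmulZl !cmulZr pq.
  by rewrite scalerA mulNr cc1 opprK scale1r scaleNr -addrA addNKr.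
have ii : 'i * 'i = -1 :> R[i] by rewrite -expr2 sqr_i.
have iN : Num.conj ('i : R[i]) = - 'i by rewrite /Num.conj/=; congr Complex;
  rewrite oppr0.
have k1 := key _ ii iN.
have k2 : rnorm (p + (- 'i) *: q) = rnorm y.
  by apply: key; rewrite ?mulrNN// rmorphN/= iN.
split.
  have -> : p = (2^-1)%:C *: ((p + 'i *: q) + (p + (- 'i) *: q)).
    by rewrite scaleNr addrACA subrr addr0 scale_half.
  exact: rnorm_average.
(* The two summands are [q - i p] and [q + i p]. *)
have -> : q = (2^-1)%:C *: ((- 'i) *: (p + 'i *: q) + 'i *: (p + (- 'i) *: q)).
  rewrite [- 'i *: _]scalerDr ['i *: (p + _)]scalerDr [- 'i *: ('i *:
    q)]scalerA.
  rewrite ['i *: (- 'i *: q)]scalerA mulNr mulrN ii opprK scale1r.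
  by rewrite addrACA scaleNr addNr add0r scale_half.
by apply: rnorm_average; rewrite ?[- 'i *: (_ + _)]scaleNr ?rnormN rnormZi.
Qed.

(** The equation [b^2 + s^2 = 2 s] is [b^2 + (1 - s)^2 = 1] written without a unit. The previous
    lemma applies to [p = b y] and [q = y - s y]. *)
Lemma rnorm_mul_of_squares b s y : cstar b = b -> cstar s = s ->
  b ** s = s ** b -> b ** b + s ** s = s + s ->
  rnorm (b ** y) <= rnorm y /\ rnorm (y - s ** y) <= rnorm y.
Proof.
move=> bb ss bs sq; apply: rnorm_le_of_squares.
  rewrite cstarB !cstarM bb ss cmulBr cmulBl !cmulA; congr (_ - _ ** _).
  by rewrite -!cmulA bs.
rewrite cstarB !cstarM bb ss cmulBr !cmulBl.
have -> : cstar y ** b ** (b ** y) = cstar y ** (b ** b) ** y by rewrite !cmulA.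
have -> : cstar y ** s ** (s ** y) = cstar y ** (s ** s) ** y by rewrite !cmulA.
have -> : cstar y ** (s ** y) = cstar y ** s ** y by rewrite cmulA.
have -> : b ** b = s + s - s ** s by rewrite -sq addrK.
rewrite cmulBr cmulDr cmulBl cmulDl.
set u := cstar y ** s ** y; set v := cstar y ** (s ** s) ** y.
set z := cstar y ** y.
by rewrite -[z - u - _]addrA -opprD [u + (u - v)]addrA addrCA subrr addr0.
Qed.

Definition self_adjoint x := cstar x = x.

Lemma closed_self_adjoint : closed self_adjoint.
Proof. exact: closed_lipschitz_eq lipschitz_star (lipschitz_map_id _). Qed.

Lemma closed_commute x : closed [set y | x ** y = y ** x].
Proof. exact: closed_lipschitz_eq (lipschitz_mull x) (lipschitz_mulr x). Qed.

(* [1 - s] is a square root of [1 - a^2]: the equation [s = (a^2 + s^2)/2] is a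
   contraction on the ball of radius [|a|]. *)
Lemma sqrt_one_minus_square a : self_adjoint a -> rnorm a < 1 ->
  exists s, [/\ self_adjoint s, a ** s = s ** a & a ** a + s ** s = s + s].
Proof.
move=> sa a1; pose S : set A :=
  [set s | (self_adjoint s /\ a ** s = s ** a) /\ rnorm s <= rnorm a].
have clS : closed S.
  apply: closed_and; last exact: closed_rnorm_le.
  by apply: closed_and; [exact: closed_self_adjoint|exact: closed_commute].
pose f s := (2^-1)%:C *: (a ** a + s ** s).
have S0 : S 0.
  split; first by split; [exact: cstar0|rewrite cmulx0 cmul0x].
  by rewrite rnorm0 rnorm_ge0.
have Sf s : S s -> S (f s).
  move=> [[ss cs] sa1]; split; first split.
  - by rewrite /self_adjoint cstarZr cstarD !cstarM sa ss.
  - rewrite /f cmulZr cmulZl cmulDr cmulDl !cmulA; congr (_ *: (_ + _)).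
    by rewrite cs -!cmulA cs.
  - rewrite /f rnormZr ger0_norm ?invr_ge0// ler_pdivrMl//.
    have n0 := rnorm_ge0 s; have a0 := rnorm_ge0 a.
    apply: le_trans (rnormD _ _) _;
      apply: le_trans (lerD (rnormM _ _) (rnormM _ _)) _.
    nra.
have fr s t : S s -> S t -> rnorm (f s - f t) <= rnorm a * rnorm (s - t).
  move=> [_ sr] [_ tr]; rewrite /f -scalerBr rnormZr ger0_norm ?invr_ge0//.
  rewrite ler_pdivrMl// opprD addrACA subrr add0r.
  have -> : s ** s - t ** t = s ** (s - t) + (s - t) ** t.
    by rewrite cmulBr cmulBl addrA subrK.
  apply: le_trans (rnormD _ _) _;
    apply: le_trans (lerD (rnormM _ _) (rnormM _ _)) _.
  have := rnorm_ge0 (s - t); nra.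
have [s [[ss cs] _] fs] := contraction_fixpoint clS S0 Sf (rnorm_ge0 a) a1 fr.
by exists s; split => //; rewrite -[in RHS]fs scale_half_add.
Qed.

End CStarBasics.

Section Contractive.
Context {R : realType} {A B : cstarAlgType R} (f : A -> B).
Hypothesis hf : star_hom f.

Lemma star_hom0 : f 0 = 0.
Proof. by rewrite -(scale0r 0) star_homZ// scale0r. Qed.

Lemma star_homN x : f (- x) = - f x.
Proof. by rewrite -scaleN1r star_homZ// scaleN1r. Qed.

Lemma star_homB x y : f (x - y) = f x - f y.
Proof. by rewrite star_homD// star_homN. Qed.

(** For self-adjoint [a] of norm below 1, [f] transports the square root attached to [a], so
    multiplication by [f a] is contractive. Applied to [f a] itself this gives [|f a|^2 <= |f a|],
    hence [|f a| <= 1]. Rescaling treats all self-adjoint elements, and the C*-identity for [x^* x]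
    treats the rest. *)
Lemma star_hom_contractive x : rnorm (f x) <= rnorm x.
Proof.
have small a : self_adjoint a -> rnorm a < 1 -> rnorm (f a) <= 1.
  move=> sa a1; have [s [ss cs sq]] := sqrt_one_minus_square sa a1.
  have [] := @rnorm_mul_of_squares _ _ (f a) (f s) (f a).
  - by rewrite -star_hom_star// sa.
  - by rewrite -star_hom_star// ss.
  - by rewrite -!star_homM// cs.
  - by rewrite -!star_homM// -!star_homD// sq.
  rewrite -{1}sa star_hom_star// rnormMstar => fa _.
  have := rnorm_ge0 (f a); nra.
have sa_le a : self_adjoint a -> rnorm (f a) <= rnorm a.
  move=> sa; apply: eps_le => e e0.
  have r0 : 0 < rnorm a + e by rewrite ltr_wpDl// rnorm_ge0.
  have := @small ((rnorm a + e)^-1%:C *: a).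
  rewrite /self_adjoint cstarZr sa => /(_ erefl).
  rewrite star_homZ// !rnormZr ger0_norm ?invr_ge0 ?(ltW r0)//.
  by rewrite ltr_pdivrMl// ler_pdivrMl// !mulr1 ltrDl; exact.
have := sa_le (cmul (cstar x) x);
  rewrite /self_adjoint cstarM cstarK => /(_ erefl).
by rewrite star_homM// star_hom_star// !rnormMstar ler_pXn2r ?nnegrE ?rnorm_ge0.
Qed.

Lemma lipschitz_star_hom : lipschitz_map f.
Proof.
by exists 1 => // x y; rewrite mul1r -star_homB star_hom_contractive.
Qed.

End Contractive.

(** * Approximate units of closed ideals *)

Record closed_ideal (R : realType) (A : cstarAlgType R) (I : set A) : Prop := {
  closed_ideal0 : I 0;
  closed_idealD : forall x y, I x -> I y -> I (x + y);
  closed_idealZ : forall (a : R[i]) x, I x -> I (a *: x);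
  closed_idealMl : forall x y, I y -> I (cmul x y);
  closed_idealMr : forall x y, I x -> I (cmul x y);
  closed_ideal_star : forall x, I x -> I (cstar x);
  closed_ideal_closed : closed I
}.

Section ApproximateUnit.
Context {R : realType} {A : cstarAlgType R}.
Implicit Types (x y z v w : A) (I : set A).
Local Notation "x ** y" := (cmul x y) (at level 40, left associativity).

Lemma closed_idealN I x : closed_ideal I -> I x -> I (- x).
Proof. by move=> hI Ix; rewrite -scaleN1r; exact: (closed_idealZ hI). Qed.

Lemma closed_idealB I x y : closed_ideal I -> I x -> I y -> I (x - y).
Proof.
by move=> hI Ix Iy; apply: (closed_idealD hI) => //; exact: closed_idealN.
Qed.

(** With [1 - s] the square root of [1 - a^2], multiplication by [1 - a^2] is the contraction
    [1 - s] applied twice. *)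
Lemma rnorm_sub_square a y : self_adjoint a -> rnorm a < 1 ->
  rnorm (y - a ** a ** y) <= rnorm y.
Proof.
move=> sa a1; have [s [ss cs sq]] := sqrt_one_minus_square sa a1.
have le z : rnorm (z - s ** z) <= rnorm z.
  by have [] := rnorm_mul_of_squares z sa ss cs sq.
apply: le_trans (le y); apply: le_trans (le (y - s ** y)).
have -> : a ** a = s + s - s ** s by rewrite -sq addrK.
by rewrite cmulBr cmulBl cmulDl cmulA !opprB !addrA [_ - s ** y + _]addrAC
  opprD addrA addrAC.
Qed.

Lemma rnorm_sub_scaled_square (c : R) v y : self_adjoint v -> rnorm v < c ->
  rnorm ((c ^+ 2)%:C *: y - v ** v ** y) <= c ^+ 2 * rnorm y.
Proof.
move=> sv vc; have c0 : 0 < c by apply: le_lt_trans vc; exact: rnorm_ge0.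
have [a [sa a1 va]] : exists a, [/\ self_adjoint a, rnorm a < 1 & v = c%:C *:
  a].
  exists (c^-1%:C *: v); split.
  - by rewrite /self_adjoint cstarZr sv.
  - by rewrite rnormZr ger0_norm ?invr_ge0 ?(ltW c0)// ltr_pdivrMl// mulr1.
  - by rewrite scalerA -rmorphM/= divff ?gt_eqF// scale1r.
have -> : (c ^+ 2)%:C *: y - v ** v ** y = (c ^+ 2)%:C *: (y - a ** a ** y).
  by rewrite va !cmulZl !cmulZr !cmulZl scalerA -rmorphM/= -expr2 scalerBr.
rewrite rnormZr ger0_norm ?exprn_ge0 ?(ltW c0)//
  ler_wpM2l ?exprn_ge0 ?(ltW c0)//.
exact: rnorm_sub_square.
Qed.

(* [w = v^2 / (1 + v^2)], the fixed point of the contraction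
   [w |-> (v^2 + (K - v^2) w) / (1 + K)] for large [K]. *)
Lemma ideal_resolvent I v : closed_ideal I -> I v -> self_adjoint v ->
  exists w, [/\ I w, self_adjoint w, v ** w = w ** v &
    w + v ** v ** w = v ** v].
Proof.
(* Since [c > |v|], multiplication by [K - v^2] has norm at most [K], and the ratio of the
   contraction is [K / (1 + K) < 1]. *)
move=> hI Iv sv; pose c := rnorm v + 1; pose K := c ^+ 2.
have K0 : 0 <= K by exact: sqr_ge0.
have K1 : 0 < 1 + K by rewrite ltr_pwDl.
pose S : set A := [set w | I w /\ (self_adjoint w /\ v ** w = w ** v)].
have clS : closed S.
  apply: closed_and; first exact: closed_ideal_closed hI.
  by apply: closed_and; [exact: closed_self_adjoint|exact: closed_commute].
pose f w := (1 + K)^-1%:C *: (v ** v + (K%:C *: w - v ** v ** w)).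
have S0 : S 0.
  split; first exact: closed_ideal0 hI.
  by split; [exact: cstar0|rewrite cmulx0 cmul0x].
have Sf w : S w -> S (f w).
  move=> [Iw [sw cw]]; split; last split.
  - apply: (closed_idealZ hI); apply: (closed_idealD hI).
      exact: (closed_idealMl hI).
    apply: (closed_idealB hI); first exact: (closed_idealZ hI).
    exact: (closed_idealMl hI).
  - rewrite /self_adjoint cstarZr cstarD cstarB cstarZr !cstarM sv sw.
    by rewrite [w ** (v ** v)]cmulA -cw -cmulA -cw cmulA.
  - rewrite /f cmulZr cmulZl cmulDr cmulDl cmulBr cmulBl cmulZr cmulZl cw.
    by rewrite !cmulA -[v ** v ** w ** v]cmulA -cw !cmulA.
have fr x y : S x -> S y -> rnorm (f x - f y) <= K / (1 + K) * rnorm (x - y).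
  move=> _ _; rewrite /f -scalerBr rnormZr ger0_norm ?invr_ge0 ?(ltW K1)//.
  rewrite mulrAC mulrC ler_wpM2r ?invr_ge0 ?(ltW K1)//.
  rewrite opprD addrACA subrr add0r opprD addrACA -scalerBr -opprD -cmulBr.
  by apply: rnorm_sub_scaled_square => //; rewrite ltrDl.
have r0 : 0 <= K / (1 + K) by rewrite divr_ge0// ltW.
have r1 : K / (1 + K) < 1 by rewrite ltr_pdivrMr// mul1r ltrDr.
have [w [Iw [sw cw]] fw] := contraction_fixpoint clS S0 Sf r0 r1 fr.
exists w; split => //.
have : (1 + K)%:C *: w = v ** v + (K%:C *: w - v ** v ** w).
  by rewrite -[in LHS]fw scalerA -rmorphM/= divff ?gt_eqF// scale1r.
rewrite rmorphD/= scalerDl scale1r addrCA => /(canRL (addrK _)).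
by rewrite addrAC subrr add0r => {1}->; rewrite subrK.
Qed.

(** Take [v = i / e], [w = v^2 / (1 + v^2)] and [d = v (1 - w) = v / (1 + v^2)]. Then
    [d^2 = w - w^2], that is [(2 d)^2 + (1 - 2 w)^2 = 1]. Contractivity of [2 d] bounds
    [i - i w = e d], and [1 - w] is the average of [1] and the contraction [1 - 2 w]. *)
Lemma ideal_approximate_unit I i (e : R) : closed_ideal I -> I i ->
  self_adjoint i -> 0 < e ->
  exists w, [/\ I w, self_adjoint w, rnorm (i - i ** w) <= e &
    forall y, rnorm (y - w ** y) <= rnorm y].
Proof.
move=> hI Ii si e0; pose v := e^-1%:C *: i.
have Iv : I v by exact: (closed_idealZ hI).
have sv : self_adjoint v by rewrite /self_adjoint cstarZr si.
have [w [Iw sw cw vw]] := ideal_resolvent hI Iv sv.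
have [d dE] : exists d, d = v - v ** w by exists (v - v ** w).
have sd : self_adjoint d by rewrite /self_adjoint dE cstarB cstarM sv sw -cw.
have dv : d ** v = w.
  by rewrite dE cmulBl -cmulA -cw cmulA -{1}vw addrK.
have dd : d ** d = w - w ** w by rewrite {2}dE cmulBr cmulA dv.
have wd : w ** d = d ** w.
  by rewrite dE cmulBr cmulBl cmulA cw.
have dw2 y : rnorm ((d + d) ** y) <= rnorm y /\ rnorm (y - (w + w) ** y) <=
  rnorm y.
  apply: rnorm_mul_of_squares.
  - by rewrite cstarD sd.
  - by rewrite cstarD sw.
  - by rewrite !cmulDl !cmulDr wd.
  - rewrite !cmulDl !cmulDr dd addrACA.
    by rewrite [w - w ** w + _ + _]addrACA subrK.
exists w; split => // [|y].
  have := (dw2 (d + d)).1; have -> : d + d = 2%:C *: d.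
    by rewrite -[2]/(1 + 1) rmorphD/= scalerDl scale1r.
  rewrite -{1}[2%:C *: d](_ : cstar (2%:C *: d) = _);
    last by rewrite cstarZr sd.
  rewrite rnormMstar rnormZr ger0_norm// => d1.
  have : rnorm d <= 1 by have := rnorm_ge0 d; nra.
  have -> : d = e^-1%:C *: (i - i ** w) by rewrite dE cmulZl scalerBr.
  by rewrite rnormZr ger0_norm ?invr_ge0 ?(ltW e0)// ler_pdivrMl// mulr1.
rewrite -[y - w ** y]scale_half rnormZr ger0_norm ?invr_ge0// ler_pdivrMl//.
rewrite addrACA -opprD -cmulDl -addrA mulrDl mul1r.
by rewrite (le_trans (rnormD _ _))// lerD2l (dw2 y).2.
Qed.

End ApproximateUnit.

(** * Quotients by closed ideals *)

Section QuotientModule.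
Context {R : realType} {A : cstarAlgType R} (I : set A) (hI : closed_ideal I).

(** The proof that [I] is a closed ideal is an argument, so that the predicate can carry the
    instance of an additive subgroup. *)
Definition ideal_pred of closed_ideal I : {pred A} := fun x => `[< I x >].

Let ideal_predP x : reflect (I x) (x \in ideal_pred hI).
Proof. exact: asboolP. Qed.

Let ideal_zmod_closed : zmod_closed (ideal_pred hI).
Proof.
split; first by apply/ideal_predP; exact: closed_ideal0 hI.
move=> x y /ideal_predP Ix /ideal_predP Iy; apply/ideal_predP.
exact: closed_idealB.
Qed.

HB.instance Definition _ :=
  GRing.isZmodClosed.Build A (ideal_pred hI) ideal_zmod_closed.

Definition cstar_quotient : Type := Quotient.quot (ideal_pred hI).
Local Notation Q := cstar_quotient.
HB.instance Definition _ := GRing.Zmodule.on Q.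

Definition quotient_map (x : A) : Q := (\pi_(Quotient.quot (ideal_pred hI))
  x)%qT.
Local Notation q := quotient_map.

Lemma quotient_map_surj (y : Q) : exists x, q x = y.
Proof. by exists (repr (y : Quotient.quot (ideal_pred hI))); exact: reprK. Qed.

Lemma quotient_mapD x y : q (x + y) = q x + q y.
Proof. by rewrite /q !piE. Qed.

Lemma quotient_mapP x y : q x = q y <-> I (x - y).
Proof.
split=> [xy|Ixy]; last by apply/eqP; rewrite -Quotient.idealrBE;
  apply/ideal_predP.
by apply/ideal_predP; rewrite Quotient.idealrBE; apply/eqP.
Qed.

Lemma quotient_map0 : q 0 = 0.
Proof. by apply: (addrI (q 0)); rewrite -quotient_mapD !addr0. Qed.

Lemma quotient_mapN x : q (- x) = - q x.
Proof. by apply: (addrI (q x));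
  rewrite -quotient_mapD !subrr quotient_map0. Qed.

Lemma quotient_map_eq0 x : q x = 0 <-> I x.
Proof. by rewrite -quotient_map0 quotient_mapP subr0. Qed.

Definition quotient_lift (y : Q) : A := sval (cid (quotient_map_surj y)).

Lemma quotient_liftK : cancel quotient_lift q.
Proof. by move=> y; rewrite /quotient_lift; case: cid. Qed.

Definition quotient_scale (a : R[i]) (y : Q) : Q := q (a *: quotient_lift y).

Lemma quotient_mapZ_def a x : q (a *: x) = quotient_scale a (q x).
Proof.
apply/quotient_mapP; rewrite -scalerBr; apply: (closed_idealZ hI).
by apply/quotient_mapP; rewrite quotient_liftK.
Qed.

Let scaleA a b y : quotient_scale a (quotient_scale b y) = quotient_scale (a *
  b) y.
Proof. by have [x <-] := quotient_map_surj y;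
  rewrite -!quotient_mapZ_def scalerA. Qed.

Let scale1 : left_id 1 quotient_scale.
Proof. by move=> y; have [x <-] := quotient_map_surj y;
  rewrite -quotient_mapZ_def scale1r. Qed.

Let scaleDr : right_distributive quotient_scale +%R.
Proof.
move=> a y z; have [x <-] := quotient_map_surj y;
  have [x' <-] := quotient_map_surj z.
by rewrite -quotient_mapD -!quotient_mapZ_def -quotient_mapD scalerDr.
Qed.

Let scaleDl y : {morph quotient_scale^~ y : a b / a + b}.
Proof.
move=> a b; have [x <-] := quotient_map_surj y.
by rewrite -!quotient_mapZ_def -quotient_mapD scalerDl.
Qed.

HB.instance Definition _ :=
  GRing.Zmodule_isLmodule.Build R[i] Q scaleA scale1 scaleDr scaleDl.

Lemma quotient_mapZ a x : q (a *: x) = a *: q x.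
Proof. exact: quotient_mapZ_def. Qed.

Definition quotient_norm (y : Q) : R := inf [set rnorm x | x in [set x | q x =
  y]].

Lemma quotient_norm_le x : quotient_norm (q x) <= rnorm x.
Proof.
apply: ge_inf; last by exists x.
by exists 0 => _ [z _ <-]; exact: rnorm_ge0.
Qed.

Lemma quotient_norm_lift (y : Q) (e : R) : 0 < e ->
  exists2 x, q x = y & rnorm x < quotient_norm y + e.
Proof.
move=> e0; have hy : has_inf [set rnorm x | x in [set x | q x = y]].
  split; first by have [x xy] := quotient_map_surj y; exists (rnorm x), x.
  by exists 0 => _ [z _ <-]; exact: rnorm_ge0.
by have [_ [x xy <-] xe] := inf_adherent e0 hy; exists x.
Qed.

Lemma quotient_norm_ge0 y : 0 <= quotient_norm y.
Proof.
apply: eps_le => e e0; have [x _ /ltW xe] := quotient_norm_lift y e0.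
exact: le_trans (rnorm_ge0 x) xe.
Qed.

Let normD (y z : Q) :
  (quotient_norm (y + z))%:C <= (quotient_norm y)%:C + (quotient_norm z)%:C.
Proof.
rewrite -rmorphD/= lecR; apply: eps_le => e e0;
  have e2 : 0 < e / 2 by rewrite divr_gt0.
have [x <- xe] := quotient_norm_lift y e2.
have [x' <- xe'] := quotient_norm_lift z e2.
rewrite -quotient_mapD (le_trans (quotient_norm_le _))//.
rewrite (le_trans (rnormD _ _))// [e]splitr addrACA.
by rewrite lerD// ltW.
Qed.

Let normZ_le a (y : Q) : quotient_norm (a *: y) <= complex.Re `|a| *
  quotient_norm y.
Proof.
have a0 : 0 <= complex.Re `|a| by rewrite -lec0R RRe_real// ger0_real.
apply: eps_le => e e0.
have e2 : 0 < e / (complex.Re `|a| + 1) by rewrite divr_gt0// ltr_wpDl.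
have [x <- xe] := quotient_norm_lift y e2.
rewrite -quotient_mapZ (le_trans (quotient_norm_le _))// rnormZ.
rewrite (le_trans (ler_wpM2l a0 (ltW xe)))// mulrDr lerD2l.
rewrite mulrCA ler_piMr ?(ltW e0)// ler_pdivrMr ?ltr_wpDl// mul1r.
by rewrite lerDl.
Qed.

(** For nonzero [a] the reverse inequality is [normZ_le] applied to [a^-1] and [a *: y]. *)
Let normZ (a : R[i]) (y : Q) : (quotient_norm (a *: y))%:C = `|a| *
  (quotient_norm y)%:C.
Proof.
have [r ar] : exists r, `|a| = r%:C.
  by exists (complex.Re `|a|); rewrite RRe_real// ger0_real.
have le1 := normZ_le a y; rewrite ar [complex.Re _]/= in le1.
rewrite ar -rmorphM; congr (_%:C); apply/eqP; rewrite eq_le le1 andTb.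
have [a0|a0] := eqVneq a 0.
  have -> : r = 0 by apply: complexI; rewrite -ar a0 normr0.
  by rewrite mul0r quotient_norm_ge0.
have r0 : 0 < r by rewrite -ltc0R -ar normr_gt0.
have := normZ_le a^-1 (a *: y); rewrite scalerA mulVf// scale1r.
by rewrite normfV ar -fmorphV [complex.Re _]/= ler_pdivlMl.
Qed.

(** A coset of norm 0 contains arbitrarily small [z], so [x] is a limit of the elements [x - z] of
    [I]; the ideal is closed. *)
Let norm0_eq0 (y : Q) : (quotient_norm y)%:C = 0 -> y = 0.
Proof.
move=> /(congr1 (@complex.Re R))/= y0; have [x xy] := quotient_map_surj y.
rewrite -xy; apply/quotient_map_eq0;
  move/closed_rnormP: (closed_ideal_closed hI).
apply=> e e0; have [z zy ze] := quotient_norm_lift y e0.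
exists (x - z); first by apply/quotient_mapP; rewrite zy.
by rewrite subKr; move: ze; rewrite y0 add0r.
Qed.

HB.instance Definition _ :=
  Lmodule_isNormed.Build R[i] Q normD normZ norm0_eq0.

Lemma rnorm_quotient (y : Q) : rnorm y = quotient_norm y.
Proof. by []. Qed.

End QuotientModule.

(** * Completeness and the C*-identity in the quotient *)

Section QuotientAlgebra.
Context {R : realType} {A : cstarAlgType R} (I : set A) (hI : closed_ideal I).
Local Notation Q := (cstar_quotient hI).
Local Notation q := (quotient_map hI).

Lemma rnorm_quotient_le x : rnorm (q x) <= rnorm x.
Proof. by rewrite rnorm_quotient quotient_norm_le. Qed.

Lemma quotient_mapB x y : q (x - y) = q x - q y.
Proof. by rewrite quotient_mapD quotient_mapN. Qed.

(** Choose points [u n] around which [F] concentrates at scale [2^-n], and lift their successive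
    differences with geometrically small norms. The partial sums of the lifts converge in [A], and
    the image of the limit is the limit of [F]. *)
Let quotient_complete (F : set_system Q) : ProperFilter F -> cauchy F -> cvg F.
Proof.
move=> FF /cauchyP Fc.
pose h n : R := (2^-1) ^+ n.
have h0 n : 0 < h n by rewrite exprn_gt0 ?invr_gt0.
have /choice[u Fu] : forall n, exists y, F [set z | rnorm (y - z) < h n].
  move=> n; have [|y Fy] := Fc (h n)%:C; first by rewrite ltc0R.
  exists y; apply: filterS Fy => z.
  by rewrite -ball_normE /= rnormE ltcR.
have uu n : rnorm (u n.+1 - u n) < 2 * h n.
  have [z [zn zSn]] := filter_ex (filterI (Fu n) (Fu n.+1)).
  apply: le_lt_trans (rnormB_triangle z _ _) _.
  rewrite /= rnormBC in zn; rewrite mulr_natl mulr2n ltrD//.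
  apply: lt_le_trans zSn _.
  by rewrite /h exprS ler_piMl ?(ltW (h0 n))// invf_le1// ler1n.
(* The constant 3 is the 2 of [uu] plus the slack 1 of the lift. *)
have /choice[d du] : forall n, exists x, q x = u n.+1 - u n /\ rnorm x <= 3 *
  h n.
  move=> n; have [x qx xle] := quotient_norm_lift (u n.+1 - u n) (h0 n).
  exists x; split => //; apply: ltW; apply: lt_trans xle _.
  by have := uu n; rewrite -rnorm_quotient; lra.
pose x n := quotient_lift (u 0%N) + \sum_(k < n) d k.
have qx n : q (x n) = u n.
  elim: n => [|n IHn]; first by rewrite /x big_ord0 addr0 quotient_liftK.
  by rewrite /x big_ord_recr/= addrA quotient_mapD IHn (du n).1 addrC subrK.
have [l xl] : exists l, forall e : R, 0 < e ->
    exists N, forall n, (N <= n)%N -> rnorm (x n - l) < e.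
  apply: (@geometric_cvg _ _ _ 3 2^-1); first by rewrite invr_ge0.
    by rewrite invf_lt1// ltr1n.
  move=> n; rewrite /x big_ord_recr/= addrA [_ + d n]addrC addrK.
  exact: (du n).2.
apply/cvg_ex; exists (q l) => P /nbhs_rnormP[e e0 eP].
have e2 : 0 < e / 2 by rewrite divr_gt0.
have [N xN] := xl _ e2.
have [|//|M hM] := @exp_small R 2^-1 1 (e / 2) _ _ e2;
  first by rewrite invr_ge0.
  by rewrite invf_lt1// ltr1n.
pose n := maxn N M.
apply: filterS (Fu n) => z zn; apply: eP.
apply: le_lt_trans (rnormB_triangle (u n) _ _) _.
rewrite [e]splitr ltrD//.
  rewrite rnormBC -qx -quotient_mapB (le_lt_trans (rnorm_quotient_le _))//.
  by apply: xN; rewrite leq_maxl.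
by apply: lt_trans zn _; rewrite -[h n]mul1r; apply: hM; rewrite leq_maxr.
Qed.

HB.instance Definition _ := Uniform_isComplete.Build Q quotient_complete.

Definition quotient_mul (y z : Q) : Q := q (cmul (quotient_lift y)
  (quotient_lift z)).
Definition quotient_star (y : Q) : Q := q (cstar (quotient_lift y)).

Let lift_sub x : I (x - quotient_lift (q x)).
Proof. by apply/(quotient_mapP hI); rewrite quotient_liftK. Qed.

Let mulE x y : q (cmul x y) = quotient_mul (q x) (q y).
Proof.
apply/quotient_mapP; set x' := quotient_lift (q x).
rewrite -[cmul x y](subrK (cmul x' y)) -cmulBl -addrA -cmulBr.
apply: (closed_idealD hI).
- by apply: (closed_idealMr hI); exact: lift_sub.
- by apply: (closed_idealMl hI); exact: lift_sub.
Qed.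

Let starE x : q (cstar x) = quotient_star (q x).
Proof.
apply/quotient_mapP; rewrite -cstarB; apply: (closed_ideal_star hI).
exact: lift_sub.
Qed.

Let liftP (P : Q -> Prop) : (forall x, P (q x)) -> forall y, P y.
Proof. by move=> Pq y; have [x <-] := quotient_map_surj y. Qed.

Let mulA y z t : quotient_mul y (quotient_mul z t) = quotient_mul
  (quotient_mul y z) t.
Proof.
elim/liftP: y => x; elim/liftP: z => y; elim/liftP: t => z.
by rewrite -!mulE cmulA.
Qed.

Let mulDl y z t : quotient_mul (y + z) t = quotient_mul y t + quotient_mul z t.
Proof.
elim/liftP: y => x; elim/liftP: z => y; elim/liftP: t => z.
by rewrite -quotient_mapD -!mulE -quotient_mapD cmulDl.
Qed.

Let mulDr y z t : quotient_mul y (z + t) = quotient_mul y z + quotient_mul y t.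
Proof.
elim/liftP: y => x; elim/liftP: z => y; elim/liftP: t => z.
by rewrite -quotient_mapD -!mulE -quotient_mapD cmulDr.
Qed.

Let mulZl (a : R[i]) y z : quotient_mul (a *: y) z = a *: quotient_mul y z.
Proof.
elim/liftP: y => x; elim/liftP: z => y.
by rewrite -quotient_mapZ -!mulE -quotient_mapZ cmulZl.
Qed.

Let mulZr (a : R[i]) y z : quotient_mul y (a *: z) = a *: quotient_mul y z.
Proof.
elim/liftP: y => x; elim/liftP: z => y.
by rewrite -quotient_mapZ -!mulE -quotient_mapZ cmulZr.
Qed.

Let starK y : quotient_star (quotient_star y) = y.
Proof. by elim/liftP: y => x; rewrite -!starE cstarK. Qed.

Let starD y z : quotient_star (y + z) = quotient_star y + quotient_star z.
Proof.
elim/liftP: y => x; elim/liftP: z => y.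
by rewrite -quotient_mapD -!starE -quotient_mapD cstarD.
Qed.

Let starZ (a : R[i]) y : quotient_star (a *: y) = Num.conj a *: quotient_star y.
Proof.
by elim/liftP: y => x; rewrite -quotient_mapZ -!starE -quotient_mapZ cstarZ.
Qed.

Let starM y z : quotient_star (quotient_mul y z) = quotient_mul (quotient_star
  z) (quotient_star y).
Proof.
by elim/liftP: y => x; elim/liftP: z => y; rewrite -mulE -!starE -mulE cstarM.
Qed.

Let rnorm_lift (y : Q) (e : R) : 0 < e ->
  exists2 x, q x = y & rnorm x < rnorm y + e.
Proof. exact: quotient_norm_lift. Qed.

Let rnorm_mul y z : rnorm (quotient_mul y z) <= rnorm y * rnorm z.
Proof.
suff le (e : R) : 0 < e ->
  rnorm (quotient_mul y z) <= (rnorm y + e) * (rnorm z + e).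
  have ny := rnorm_ge0 y; have nz := rnorm_ge0 z.
  have s0 : 0 < rnorm y + rnorm z + 1 by lra.
  apply: eps_le => e e0.
  (* As [t <= 1], the product [(|y| + t) (|z| + t)] exceeds [|y| |z|] by at most
     [t (|y| + |z| + 1) <= e]. *)
  pose t := Num.min 1 (e / (rnorm y + rnorm z + 1)).
  have t0 : 0 < t by rewrite lt_min ltr01 divr_gt0.
  have t1 : t <= 1 by rewrite ge_min lexx.
  have te : t * (rnorm y + rnorm z + 1) <= e
    by rewrite -ler_pdivlMr// ge_min lexx orbT.
  have := le t t0; nra.
move=> e0; have [x <- xe] := rnorm_lift y e0;
  have [x' <- xe'] := rnorm_lift z e0.
rewrite -mulE (le_trans (rnorm_quotient_le _))// (le_trans (rnormM _ _))//.
by apply: ler_pM; rewrite ?rnorm_ge0 ?ltW.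
Qed.

Let rnorm_star_le y : rnorm (quotient_star y) <= rnorm y.
Proof.
apply: eps_le => e e0; have [x <- /ltW xe] := rnorm_lift y e0.
by rewrite -starE (le_trans (rnorm_quotient_le _))// rnorm_star.
Qed.

(* Compressing [x^* x + i] by [1 - w], with [w] an approximate unit for the
   self-adjoint part of [i], leaves [(x - x w)^* (x - x w)] up to [e]. *)
Let sqr_rnorm_le x i : I i -> rnorm (q x) ^+ 2 <= rnorm (cmul (cstar x) x + i).
Proof.
move=> Ii; pose z := cmul (cstar x) x; pose j := (2^-1)%:C *: (i + cstar i).
have zs : cstar z = z by rewrite cstarM cstarK.
have Ij : I j.
  by apply: (closed_idealZ hI); apply: (closed_idealD hI) => //;
    exact: (closed_ideal_star hI).
have sj : self_adjoint j by rewrite /self_adjoint cstarZr cstarD cstarK addrC.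
(* [z + j] is the self-adjoint part of [z + i], so its norm is no larger. *)
apply: (@le_trans _ _ (rnorm (z + j))); last first.
  have -> : z + j = (2^-1)%:C *: ((z + i) + cstar (z + i)).
    by rewrite cstarD zs addrACA scalerDr scale_half.
  rewrite rnormZr ger0_norm ?invr_ge0// ler_pdivrMl// mulr_natl mulr2n.
  by rewrite (le_trans (rnormD _ _))// rnorm_star.
apply: eps_le => e e0.
have [w [Iw sw jw wle]] := ideal_approximate_unit hI Ij sj e0.
have wre y : rnorm (y - cmul y w) <= rnorm y.
  by rewrite -rnorm_star cstarB cstarM sw (le_trans (wle _))// rnorm_star.
have qx : q x = q (x - cmul x w).
  by apply/quotient_mapP; rewrite subKr; exact: (closed_idealMl hI).
rewrite qx; apply: (@le_trans _ _ (rnorm (x - cmul x w) ^+ 2)).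
  by rewrite ler_pXn2r ?nnegrE ?rnorm_ge0 ?rnorm_quotient_le.
rewrite -rnormMstar.
(* [T y] is [(1 - w) y (1 - w)] written without a unit. *)
pose T y := (y - cmul y w) - cmul w (y - cmul y w).
have TB a b : T (a - b) = T a - T b.
  have SB : a - b - cmul (a - b) w = (a - cmul a w) - (b - cmul b w).
    by rewrite cmulBl !opprD addrACA.
  rewrite /T SB; move: (a - cmul a w) (b - cmul b w) => p r.
  by rewrite cmulBr !opprD addrACA.
have -> : cmul (cstar (x - cmul x w)) (x - cmul x w) = T z.
  rewrite cstarB cstarM sw cmulBl -cmulA /T.
  by have -> : z - cmul z w = cmul (cstar x) (x - cmul x w)
    by rewrite cmulBr cmulA.
have -> : T z = T (z + j) - T j by rewrite -TB addrK.
apply: le_trans (rnormD _ _) _; rewrite rnormN lerD//.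
  exact: le_trans (wle _) (wre _).
exact: le_trans (wle _) jw.
Qed.

(** One inequality is submultiplicativity; for the other, every lift of [y^* y] has the form treated
    in [sqr_rnorm_le]. *)
Let norm_star (y : Q) : `|quotient_mul (quotient_star y) y| = `|y| ^+ 2.
Proof.
rewrite !rnormE -rmorphXn/=; congr (_%:C); apply/eqP; rewrite eq_le.
apply/andP; split.
  by rewrite (le_trans (rnorm_mul _ _))// expr2 ler_wpM2r ?rnorm_ge0.
apply: eps_le => e e0.
have [x xy xe] := rnorm_lift (quotient_mul (quotient_star y) y) e0.
elim/liftP: y xy xe => y; rewrite -starE -mulE => /quotient_mapP Ixy xe.
apply: le_trans (ltW xe); rewrite -[x](subrK (cmul (cstar y) y)) addrC.
exact: sqr_rnorm_le.
Qed.

Let normM (y z : Q) : `|quotient_mul y z| <= `|y| * `|z|.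
Proof. by rewrite !rnormE -rmorphM/= lecR. Qed.

HB.instance Definition _ := isCStarAlgebra.Build R Q
  mulA mulDl mulDr mulZl mulZr starK starD starZ starM normM norm_star.

Lemma star_hom_quotient_map : star_hom (q : A -> Q).
Proof.
split; [exact: quotient_mapD|exact: quotient_mapZ|exact: mulE|exact: starE].
Qed.

Lemma rnorm_quotient_lift (x : A) (e : R) : 0 < e ->
  exists2 i, I i & rnorm (x - i) < rnorm (q x) + e.
Proof.
move=> e0; have [y /quotient_mapP xy ye] := rnorm_lift (q x) e0.
exists (x - y); last by rewrite subKr.
by rewrite -opprB; exact: closed_idealN.
Qed.

End QuotientAlgebra.

(** * Closed ideals and Cuntz-Krieger families *)

Section StarHom.
Context {R : realType}.
Implicit Types A B C : cstarAlgType R.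

Lemma star_hom_id A : star_hom (fun x : A => x).
Proof. by []. Qed.

Lemma star_hom_comp A B C (g : B -> C) (f : A -> B) :
  star_hom g -> star_hom f -> star_hom (fun x => g (f x)).
Proof.
move=> hg hf; split=> [x y|a x|x y|x].
- by rewrite !star_homD.
- by rewrite !star_homZ.
- by rewrite !star_homM.
- by rewrite !star_hom_star.
Qed.

Lemma star_hom_fsum A B (f : A -> B) (T : choiceType) (D : set T) (F : T -> A) :
  star_hom f -> finite_set D ->
  f (\sum_(i \in D) F i) = \sum_(i \in D) f (F i).
Proof.
move=> hf fD; rewrite !fsbig_finite//.
by apply: (big_morph f); [exact: star_homD|exact: star_hom0].
Qed.

Lemma cmul_fsuml A (x : A) (T : choiceType) (D : set T) (F : T -> A) :
  finite_set D -> cmul (\sum_(i \in D) F i) x = \sum_(i \in D) cmul (F i) x.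
Proof.
move=> fD; rewrite !fsbig_finite//.
by apply: (big_morph (fun y => cmul y x)) => [y z|]; rewrite ?cmulDl ?cmul0x.
Qed.

Lemma cstar_fsum A (T : choiceType) (D : set T) (F : T -> A) :
  finite_set D -> cstar (\sum_(i \in D) F i) = \sum_(i \in D) cstar (F i).
Proof.
move=> fD; rewrite !fsbig_finite//.
by apply: (big_morph (@cstar R A)); [exact: cstarD|exact: cstar0].
Qed.

Lemma closed_ideal_ker A B (f : A -> B) : star_hom f ->
  closed_ideal [set x | f x = 0].
Proof.
move=> hf; split=> /=.
- exact: star_hom0.
- by move=> x y x0 y0; rewrite star_homD// x0 y0 addr0.
- by move=> a x x0; rewrite star_homZ// x0 scaler0.
- by move=> x y y0; rewrite star_homM// y0 cmulx0.
- by move=> x y x0; rewrite star_homM// x0 cmul0x.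
- by move=> x x0; rewrite star_hom_star// x0 cstar0.
- exact: closed_lipschitz_preimage (lipschitz_star_hom hf) (@closed_singleton0
    _ B).
Qed.

End StarHom.

(** * Closed ideals generated by a set, and their products *)

Section IdealSpan.
Context {R : realType} {A : cstarAlgType R}.
Implicit Types (G I : set A) (x y z : A).
Local Notation "x ** y" := (cmul x y) (at level 40, left associativity).

Definition ideal_span G : set A :=
  [set x | forall I, closed_ideal I -> G `<=` I -> I x].

Lemma ideal_span_sub G : G `<=` ideal_span G.
Proof. by move=> x Gx I _; exact. Qed.

Lemma ideal_span_min G I : closed_ideal I -> G `<=` I -> ideal_span G `<=` I.
Proof. by move=> hI GI x; exact. Qed.

Lemma closed_ideal_span G : closed_ideal (ideal_span G).
Proof.
split.
- by move=> I hI _; exact: closed_ideal0 hI.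
- by move=> x y Sx Sy I hI GI; apply: (closed_idealD hI); [exact: Sx|exact: Sy].
- by move=> a x Sx I hI GI; apply: (closed_idealZ hI); exact: Sx.
- by move=> x y Sy I hI GI; apply: (closed_idealMl hI); exact: Sy.
- by move=> x y Sx I hI GI; apply: (closed_idealMr hI); exact: Sx.
- by move=> x Sx I hI GI; apply: (closed_ideal_star hI); exact: Sx.
- apply/closed_rnormP => x xe I hI GI.
  move/closed_rnormP: (closed_ideal_closed hI); apply => e e0.
  by have [y Sy xy] := xe e e0; exists y => //; exact: Sy.
Qed.

(** The factor [a] in the middle makes the annihilator stable under left multiplication, and
    imposing the condition on [cstar y] as well makes it stable under the involution. *)
Lemma closed_ideal_annihilator (x : A) :
  closed_ideal [set y | forall a, x ** a ** y = 0 /\ x ** a ** cstar y = 0].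
Proof.
split=> /=.
- by move=> a; rewrite cstar0 cmulx0.
- by move=> y z yx zx a; have [y1 y2] := yx a; have [z1 z2] := zx a;
    rewrite cstarD !cmulDr y1 y2 z1 z2 addr0.
- by move=> c y yx a; have [y1 y2] := yx a;
    rewrite cstarZ !cmulZr y1 y2 !scaler0.
- move=> z y yx a; rewrite cstarM !cmulA -[x ** a ** z]cmulA.
  by rewrite (yx (a ** z)).1 (yx a).2 cmul0x.
- move=> y z yx a; rewrite cstarM !cmulA -[x ** a ** cstar z]cmulA.
  by rewrite (yx a).1 (yx (a ** cstar z)).2 cmul0x.
- by move=> y yx a; rewrite cstarK; have [] := yx a.
- apply: closed_forall => a; apply: closed_and.
    exact: closed_lipschitz_preimage (lipschitz_mull _) (@closed_singleton0 _
      A).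
  apply: (@closed_lipschitz_preimage _ _ _ _ [set z | z = 0]).
    exact: lipschitz_map_comp (lipschitz_mull _) lipschitz_star.
  exact: closed_singleton0.
Qed.

(** The annihilator of a generator in [G1] contains [G2], hence [y]. Taking adjoints, the
    annihilator of [y^*] contains [G1], hence [x]. So [y^* a x = 0] for all [a], and [a = x^*] makes
    the square of [x y] vanish. *)
Lemma ideal_span_mul_eq0 G1 G2 : G1 `<=` self_adjoint -> G2 `<=` self_adjoint ->
  (forall x y a, G1 x -> G2 y -> x ** a ** y = 0) ->
  forall x y, ideal_span G1 x -> ideal_span G2 y -> x ** y = 0.
Proof.
move=> sa1 sa2 G12 x y Sx Sy.
have G1S z a : G1 z -> z ** a ** y = 0.
  move=> Gz; suff /(_ a)[] : forall a, z ** a ** y = 0 /\ z ** a ** cstar y =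
    0 by [].
  apply: (ideal_span_min (closed_ideal_annihilator z) _ Sy).
  by move=> t Gt b; rewrite (sa2 t Gt) G12.
have SS a : cstar y ** a ** x = 0.
  suff /(_ a)[] : forall a, cstar y ** a ** x = 0 /\ cstar y ** a ** cstar x =
    0 by [].
  apply: (ideal_span_min (closed_ideal_annihilator (cstar y)) _ Sx).
  move=> t Gt b; rewrite (sa1 t Gt).
  suff -> : cstar y ** b ** t = 0 by [].
  apply: (can_inj (@cstarK R A)).
  by rewrite cstar0 !cstarM cstarK (sa1 t Gt) cmulA G1S.
by apply: cstarM_eq0; rewrite cstarM cmulA SS cmul0x.
Qed.

End IdealSpan.

Section CKFamilyTheory.
Context {R : realType} {B : cstarAlgType R} {E : relgraph}.
Context {p : vtx E -> B} {s : edg E -> B} (ck : ck_family p s).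
Local Notation "x ** y" := (cmul x y) (at level 40, left associativity).

Lemma ck_cstar_p v : cstar (p v) = p v.
Proof. by have [] := ck_projection ck v. Qed.

Lemma ck_pp v : p v ** p v = p v.
Proof. by have [] := ck_projection ck v. Qed.

Lemma ck_s_rng e : s e ** p (rng e) = s e.
Proof. by rewrite -(ck_source ck) cmulA (ck_partial_isometry ck). Qed.

Lemma ck_src_s e : p (src e) ** s e = s e.
Proof.
have le := ck_le ck e; rewrite /projection_le in le.
by rewrite -{1}(ck_partial_isometry ck e) cmulA le (ck_partial_isometry ck).
Qed.

Lemma ck_p_s v e : v <> src e -> p v ** s e = 0.
Proof. by move=> ve; rewrite -(ck_src_s e) cmulA (ck_orthogonal ck ve) cmul0x.
  Qed.

Lemma ck_star_s e f : e <> f -> cstar (s e) ** s f = 0.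
Proof.
move=> ef; have -> : cstar (s e) = cstar (s e) ** (s e ** cstar (s e)).
  by rewrite -{1}(ck_partial_isometry ck e) !cstarM cstarK.
rewrite -(ck_partial_isometry ck f) -cmulA.
by rewrite [s e ** _ ** _]cmulA (ck_ranges ck ef) cmul0x cmulx0.
Qed.

Lemma ck_star_src e : cstar (s e) ** p (src e) = cstar (s e).
Proof. by rewrite -{1}(ck_cstar_p (src e)) -cstarM ck_src_s. Qed.

Lemma ck_star_p v e : v <> src e -> cstar (s e) ** p v = 0.
Proof. by move=> ve; rewrite -{1}(ck_cstar_p v) -cstarM ck_p_s// cstar0. Qed.

Lemma ck_rng_star e : p (rng e) ** cstar (s e) = cstar (s e).
Proof. by rewrite -{1}(ck_cstar_p (rng e)) -cstarM ck_s_rng. Qed.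

End CKFamilyTheory.

Section Generators.
Context {R : realType} {E : relgraph} (U : relgraph_calg R E).
Local Notation p := (calg_p U).
Local Notation s := (calg_s U).
Local Notation ck := (calg_family U).
Local Notation "x ** y" := (cmul x y) (at level 40, left associativity).

(** Contractivity makes the equaliser closed, so it is a closed *-subalgebra containing the
    generators. *)
Lemma calg_hom_ext (B : cstarAlgType R) (f g : U -> B) :
  star_hom f -> star_hom g -> (forall v, f (p v) = g (p v)) ->
  (forall e, f (s e) = g (s e)) -> forall x, f x = g x.
Proof.
move=> hf hg fgp fgs x.
suff /seteqP[_ /(_ x Logic.I)] : [set x | f x = g x] = setT by [].
apply: (@calg_generated _ _ U).
- split=> /=.
  + by rewrite !star_hom0.
  + by move=> y z yE zE; rewrite !star_homD// yE zE.
  + by move=> a y yE; rewrite !star_homZ// yE.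
  + by move=> y z yE zE; rewrite !star_homM// yE zE.
  + by move=> y yE; rewrite !star_hom_star// yE.
  + exact: closed_lipschitz_eq (lipschitz_star_hom hf) (lipschitz_star_hom hg).
- by move=> _ [v _ <-].
- by move=> _ [e _ <-].
Qed.

(** An induction principle that builds [s_mu s_nu^*] outwards from a vertex projection: edges enter
    only on the left and their adjoints only on the right, so no product [s_e^* s_f] has to be
    treated. *)
Record monomial_closed (W : set U) : Prop := {
  monomial_closed_closed : closed W;
  monomial_closed0 : W 0;
  monomial_closedD : forall x y, W x -> W y -> W (x + y);
  monomial_closedZ : forall (a : R[i]) x, W x -> W (a *: x);
  monomial_closed_p : forall v, W (p v);
  monomial_closed_pl : forall v x, W x -> W (p v ** x);
  monomial_closed_pr : forall v x, W x -> W (x ** p v);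
  monomial_closed_sl : forall e x, W x -> W (s e ** x);
  monomial_closed_sr : forall e x, W x -> W (x ** cstar (s e))
}.

(* The algebra is the closed span of the monomials [s_mu s_nu^*]. *)
Lemma monomial_closedT (W : set U) : monomial_closed W -> forall x, W x.
Proof.
pose W0 : set U := [set x | forall W, monomial_closed W -> W x].
have W0c : monomial_closed W0.
  split.
  - apply/closed_rnormP => x xe W' hW.
    move/closed_rnormP: (monomial_closed_closed hW); apply => e e0.
    by have [y Sy xy] := xe e e0; exists y => //; exact: Sy.
  - by move=> W' hW; exact: monomial_closed0 hW.
  - by move=> x y Wx Wy W' hW; apply: (monomial_closedD hW);
      [exact: Wx|exact: Wy].
  - by move=> a x Wx W' hW; apply: (monomial_closedZ hW); exact: Wx.
  - by move=> v W' hW; exact: (monomial_closed_p hW).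
  - by move=> v x Wx W' hW; apply: (monomial_closed_pl hW); exact: Wx.
  - by move=> v x Wx W' hW; apply: (monomial_closed_pr hW); exact: Wx.
  - by move=> e x Wx W' hW; apply: (monomial_closed_sl hW); exact: Wx.
  - by move=> e x Wx W' hW; apply: (monomial_closed_sr hW); exact: Wx.
have min0 W' : monomial_closed W' -> W0 `<=` W' by move=> hW x; exact.
have [cl0 W00 D0 Z0 p0 pl0 pr0 sl0 sr0] := W0c.
have star0 : W0 `<=` [set x | W0 (cstar x)].
  apply: min0; split=> /=.
  - exact: closed_lipschitz_preimage lipschitz_star cl0.
  - by rewrite cstar0.
  - by move=> x y Wx Wy; rewrite cstarD; exact: D0.
  - by move=> a x Wx; rewrite cstarZ; exact: Z0.
  - by move=> v; rewrite (ck_cstar_p ck).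
  - by move=> v x Wx; rewrite cstarM (ck_cstar_p ck); exact: pr0.
  - by move=> v x Wx; rewrite cstarM (ck_cstar_p ck); exact: pl0.
  - by move=> e x Wx; rewrite cstarM; exact: sr0.
  - by move=> e x Wx; rewrite cstarM cstarK; exact: sl0.
(* An adjoint edge on the left is absorbed by the first factor: [s_e^* p_v] is [s_e^*] or 0, and
   [s_e^* s_f] is a vertex projection or 0. *)
have stars0 e : W0 `<=` [set x | W0 x /\ W0 (cstar (s e) ** x)].
  apply: min0; split=> /=.
  - apply: closed_and => //.
    exact: closed_lipschitz_preimage (lipschitz_mull _) cl0.
  - by rewrite cmulx0.
  - by move=> x y [Wx sx] [Wy sy]; rewrite cmulDr; split; exact: D0.
  - by move=> a x [Wx sx]; rewrite cmulZr; split; exact: Z0.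
  - move=> v; split; first exact: p0.
    have [->|ve] := eqVneq v (src e); last by rewrite (ck_star_p ck)//;
      exact/eqP.
    by rewrite (ck_star_src ck) -(ck_rng_star ck); apply: sr0; exact: p0.
  - move=> v x [Wx sx]; split; first exact: pl0.
    have [->|ve] := eqVneq v (src e); first by rewrite cmulA (ck_star_src ck).
    by rewrite cmulA (ck_star_p ck) ?cmul0x//; exact/eqP.
  - by move=> v x [Wx sx]; rewrite cmulA; split; exact: pr0.
  - move=> f x [Wx sx]; split; first exact: sl0.
    have [<-|ef] := eqVneq e f; first by rewrite cmulA (ck_source ck);
      exact: pl0.
    by rewrite cmulA (ck_star_s ck) ?cmul0x//; exact/eqP.
  - by move=> f x [Wx sx]; rewrite cmulA; split; exact: sr0.
(* The elements that preserve [W0] by left multiplication, together with their adjoints, form a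
   closed *-subalgebra containing the generators. *)
have left0 x : forall y, W0 y -> W0 (x ** y).
  suff : [set x | forall y, W0 y -> W0 (x ** y) /\ W0 (cstar x ** y)] = setT.
    by move=> /seteqP[_ /(_ x Logic.I) h] y /h[].
  apply: (@calg_generated _ _ U); first split=> /=.
  - by move=> y Wy; rewrite cstar0 cmul0x.
  - move=> a b ha hb y Wy; have [a1 a2] := ha y Wy; have [b1 b2] := hb y Wy.
    by rewrite cstarD !cmulDl; split; exact: D0.
  - move=> c a ha y Wy; have [a1 a2] := ha y Wy.
    by rewrite cstarZ !cmulZl; split; exact: Z0.
  - move=> a b ha hb y Wy; rewrite cstarM -!cmulA; split.
      by apply: (ha _ _).1; exact: (hb y Wy).1.
    by apply: (hb _ _).2; exact: (ha y Wy).2.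
  - by move=> a ha y Wy; rewrite cstarK; have [] := ha y Wy.
  - apply: closed_forall => y; apply: closed_forall => Wy; apply: closed_and.
      exact: closed_lipschitz_preimage (lipschitz_mulr _) cl0.
    apply: closed_lipschitz_preimage cl0.
    exact: lipschitz_map_comp (lipschitz_mulr _) lipschitz_star.
  - by move=> _ [v _ <-] y Wy; rewrite (ck_cstar_p ck); split; exact: pl0.
  - by move=> _ [e _ <-] y Wy; split; [exact: sl0|have [] := stars0 e y Wy].
have all0 : W0 = setT.
  apply: (@calg_generated _ _ U); first by split => // x y _; exact: left0.
    by move=> _ [v _ <-]; exact: p0.
  by move=> _ [e _ <-]; rewrite -(ck_s_rng ck); apply: sl0; exact: p0.
by move=> hW x; apply: (min0 W hW); rewrite all0.
Qed.

End Generators.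

(** * Kernels of canonical surjections *)

Lemma fsbig_out_edges (F E : relgraph) (a : relmorph F E) (W : zmodType)
  (g : edg E -> W) v : (forall e, ~ range (medg a) e -> g e = 0) ->
  \sum_(e \in out_edges v) g (medg a e) =
  \sum_(e \in out_edges (mvtx a v)) g e.
Proof.
move=> g0; rewrite -(fsbig_image _ (medg a) g); last first.
  by move=> x y _ _; exact: medg_inj.
apply: fsbig_widen => e /=.
  by move=> [e' ev' <-]; rewrite /out_edges /= src_medg ev'.
move=> [ev ne]; apply: g0 => -[e' _ ee'].
apply: ne; exists e' => //; apply: (@mvtx_inj _ _ a).
by rewrite -src_medg ee'.
Qed.

Section Kernel.
Context {R : realType} {F E : relgraph} (a : relmorph F E).
Context (UE : relgraph_calg R E) (UF : relgraph_calg R F).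
Local Notation p := (calg_p UE).
Local Notation s := (calg_s UE).
Local Notation ck := (calg_family UE).
Local Notation "x ** y" := (cmul x y) (at level 40, left associativity).

(** Only the edges that stay in [F] are subtracted: those leaving [F] become 0 in the quotient. *)
Definition gap (v : vtx F) : UE :=
  p (mvtx a v) - \sum_(e \in out_edges v) s (medg a e) ** cstar (s (medg a e)).

Definition new_marked : set (vtx F) :=
  [set v | marked F v /\ ~ marked E (mvtx a v)].

Definition kernel_generators : set UE :=
  p @` (~` range (mvtx a)) `|` gap @` new_marked.

Lemma finite_out_edges v : marked F v -> finite_set (out_edges v).
Proof. by move=> /marked_regular[]. Qed.

(** If the range were in [F], heredity of the complement would put the source in [F] too, and
    fullness would make [e] an edge of [F]. *)
Lemma rng_out_range e : ~ range (medg a) e -> ~ range (mvtx a) (rng e).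
Proof.
move=> ne re; apply: ne; rewrite relmorph_full; split => //.
by apply: contrapT => ns; exact: (relmorph_hereditary ns).
Qed.

Lemma star_hom_s_out (B : cstarAlgType R) (f : UE -> B) e : star_hom f ->
  (forall v, ~ range (mvtx a) v -> f (p v) = 0) ->
  ~ range (medg a) e -> f (s e) = 0.
Proof.
move=> hf f0 ne; rewrite -(ck_s_rng ck) star_homM// f0 ?cmulx0//.
exact: rng_out_range.
Qed.

Lemma gap_self_adjoint v : marked F v -> self_adjoint (gap v).
Proof.
move=> mv; rewrite /self_adjoint cstarB (ck_cstar_p ck) cstar_fsum;
  last exact: finite_out_edges.
by congr (_ - _); apply: eq_fsbigr => e _; rewrite cstarM cstarK.
Qed.

Lemma kernel_generators_self_adjoint : kernel_generators `<=` self_adjoint.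
Proof.
move=> _ [[v _ <-]|[v [mv _] <-]]; first exact: ck_cstar_p ck _.
exact: gap_self_adjoint.
Qed.

Lemma gap_p v : marked F v -> gap v ** p (mvtx a v) = gap v.
Proof.
move=> mv; rewrite /gap cmulBl (ck_pp ck) cmul_fsuml;
  last exact: finite_out_edges.
congr (_ - _); apply: eq_fsbigr => e; rewrite inE => <-.
by rewrite -cmulA -src_medg (ck_star_src ck).
Qed.

(** Orthogonality of ranges leaves only the summand of [e] itself, which cancels [p_v s_e = s_e]; if
    [e] starts elsewhere, every term vanishes. *)
Lemma gap_s v e : marked F v -> range (medg a) e -> gap v ** s e = 0.
Proof.
move=> mv [e' _ <-]; rewrite /gap cmulBl cmul_fsuml;
  last exact: finite_out_edges.
have [ev|ev] := pselect (src e' = v).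
  rewrite (fsbigD1 e')/=;
    [|exact: sub_finite_set (finite_out_edges mv)|exact: ev].
  rewrite fsbig1 => [|f [_ fe]]; last first.
    rewrite -cmulA (ck_star_s ck) ?cmulx0// => /medg_inj fe'.
    exact: fe.
  by rewrite addr0 (ck_partial_isometry ck) -ev -src_medg (ck_src_s ck) subrr.
rewrite fsbig1 => [|f fv]; last first.
  rewrite -cmulA (ck_star_s ck) ?cmulx0// => /medg_inj fe'.
  by apply: ev; rewrite -fe'.
rewrite (ck_p_s ck) ?subr0// src_medg => /mvtx_inj ve.
by apply: ev.
Qed.

(** Only the summation relation needs the generators of the kernel. At a vertex marked in [E] the
    edges leaving [F] drop out of the sum; at a newly marked vertex the relation says that [f] kills
    the gap. *)
Lemma restrict_family (B : cstarAlgType R) (f : UE -> B) : star_hom f ->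
  (forall x, kernel_generators x -> f x = 0) ->
  ck_family (fun v => f (p (mvtx a v))) (fun e => f (s (medg a e))).
Proof.
move=> hf f0; have [h1 h2 h3 h4 h5 h6 h7] := ck.
have fp0 v : ~ range (mvtx a) v -> f (p v) = 0.
  by move=> nv; apply: f0; left; exists v.
split.
- move=> v; have [pv ppv] := h1 (mvtx a v).
  by split; rewrite -?star_hom_star -?star_homM// ?pv ?ppv.
- move=> v w vw; rewrite -star_homM// h2 ?star_hom0//.
  by move=> /mvtx_inj.
- by move=> e; rewrite -star_hom_star// -!star_homM// h3.
- move=> e e' ee'; rewrite -!star_hom_star// -!star_homM// h4 ?star_hom0//.
  by move=> /medg_inj.
- by move=> e; rewrite -star_hom_star// -!star_homM// h5 rng_medg.
- move=> e; rewrite /projection_le -star_hom_star// -!star_homM//.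
  by congr f; rewrite -src_medg; exact: h6.
- move=> v mv; under eq_fsbigr do rewrite -star_hom_star// -star_homM//.
  have [mav|nmav] := pselect (marked E (mvtx a v)).
    rewrite h7// star_hom_fsum//; last by have [] := marked_regular mav.
    rewrite (fsbig_out_edges (g := fun e => f (s e ** cstar (s e))))// => e ne.
    by rewrite star_homM// (star_hom_s_out hf fp0 ne) cmul0x.
  apply: subr0_eq; rewrite -star_hom_fsum//; last exact: finite_out_edges.
  by rewrite -star_homB//; apply: f0; right; exists v.
Qed.

Local Notation I := (ideal_span kernel_generators).
Local Notation hI := (closed_ideal_span kernel_generators).
Local Notation Q := (cstar_quotient hI).
Local Notation q := (quotient_map hI).
Local Notation canon := (canonical_surjection a UE UF).

Lemma star_hom_canonical : star_hom canon.
Proof. exact: universal_map_hom. Qed.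

Let family_quotient :
  ck_family (fun v => q (p (mvtx a v)) : Q) (fun e => q (s (medg a e)) : Q).
Proof.
apply: restrict_family; first exact: star_hom_quotient_map.
by move=> x Gx; apply/quotient_map_eq0; exact: ideal_span_sub.
Qed.

Let h : UF -> Q := universal_map UF family_quotient.

Let hh : star_hom h. Proof. exact: universal_map_hom. Qed.

(** The factorisation of [q] through [canon]: it shows that the kernel of [canon] is no larger than
    the ideal. *)
Let h_canonical x : h (canon x) = q x.
Proof.
apply: (calg_hom_ext (f := fun x => h (canon x)) (g := q : UE -> Q)).
- exact: star_hom_comp hh star_hom_canonical.
- exact: star_hom_quotient_map.
- move=> v; have [[v' _ <-]|nv] := pselect (range (mvtx a) v).
    by rewrite canonical_surjection_p /h universal_map_p.
  rewrite canonical_surjection_p_out// star_hom0//; apply/esym/quotient_map_eq0.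
  by apply: ideal_span_sub; left; exists v.
- move=> e; have [[e' _ <-]|ne] := pselect (range (medg a) e).
    by rewrite canonical_surjection_s /h universal_map_s.
  rewrite canonical_surjection_s_out// star_hom0//; apply/esym.
  apply: (star_hom_s_out (star_hom_quotient_map hI) _ ne) => v nv.
  by apply/quotient_map_eq0; apply: ideal_span_sub; left; exists v.
Qed.

Lemma canonical_gap v : marked F v -> canon (gap v) = 0.
Proof.
move=> mv; have hc := star_hom_canonical.
rewrite (star_homB hc) canonical_surjection_p (star_hom_fsum _ hc);
  last exact: finite_out_edges.
rewrite (ck_sum (calg_family UF) mv); apply/eqP; rewrite subr_eq0; apply/eqP.
apply: eq_fsbigr => e _.
by rewrite (star_homM hc) (star_hom_star hc) canonical_surjection_s.
Qed.

Lemma canonical_kernel x : canon x = 0 <-> I x.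
Proof.
split=> [x0|Ix]; first by apply/(quotient_map_eq0 hI);
  rewrite -h_canonical x0 star_hom0.
apply: (ideal_span_min (closed_ideal_ker star_hom_canonical) _ Ix).
move=> _ [[v nv <-]|[v [mv _] <-]] /=; last exact: canonical_gap.
exact: canonical_surjection_p_out.
Qed.

(** The distance from [x] to the ideal is [|q x| = |h (canon x)|], and [h] is contractive. *)
Lemma canonical_lift_norm x (e : R) : 0 < e ->
  exists2 i, I i & rnorm (x - i) < rnorm (canon x) + e.
Proof.
move=> e0; have [i Ii xi] := rnorm_quotient_lift hI x e0; exists i => //.
apply: lt_le_trans xi _; rewrite lerD2r -h_canonical.
exact: star_hom_contractive.
Qed.

(** [canon] factors through the quotient as [k], and [k] composed with [h] fixes the generators,
    hence is the identity; a lift of [h y] is therefore a preimage. *)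
Lemma canonical_surjective y : exists x, canon x = y.
Proof.
pose k (z : Q) := canon (quotient_lift z).
have kq x : k (q x) = canon x.
  apply/subr0_eq; rewrite /k -(star_homB star_hom_canonical).
  by apply/canonical_kernel/(quotient_mapP hI); rewrite quotient_liftK.
have hk : star_hom k.
  have hq := star_hom_quotient_map hI; have hc := star_hom_canonical.
  split=> [x z|c x|x z|x].
  - have [{}x <-] := quotient_map_surj x; have [{}z <-] := quotient_map_surj z.
    by rewrite -star_homD// !kq star_homD.
  - by have [{}x <-] := quotient_map_surj x; rewrite -star_homZ// !kq star_homZ.
  - have [{}x <-] := quotient_map_surj x; have [{}z <-] := quotient_map_surj z.
    by rewrite -star_homM// !kq star_homM.
  - by have [{}x <-] := quotient_map_surj x;
      rewrite -star_hom_star// !kq star_hom_star.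
exists (quotient_lift (h y)).
apply: (calg_hom_ext (f := fun y => k (h y)) (g := fun y => y)).
- exact: star_hom_comp.
- exact: star_hom_id.
- by move=> v; rewrite /h universal_map_p kq canonical_surjection_p.
- by move=> e; rewrite /h universal_map_s kq canonical_surjection_s.
Qed.

End Kernel.
Arguments gap {R F E} a UE v.
Arguments kernel_generators {R F E} a UE _.

(** * Orthogonality and gauge actions *)

Section Orthogonality.
Context {R : realType} {E : relgraph} (U : relgraph_calg R E).
Implicit Types (H V : set (vtx E)) (T : set (edg E)).
Local Notation p := (calg_p U).
Local Notation s := (calg_s U).
Local Notation ck := (calg_family U).
Local Notation "x ** y" := (cmul x y) (at level 40, left associativity).

(* [x] is right-supported at a single vertex; under the hypotheses of
   [supported_s], if [x s_mu] is nonzero for a path [mu] of positive length,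
   then [mu] ends in [H]. *)
Definition supported H V T (x : U) : Prop :=
  exists2 w, x ** p w = x & H w \/ V w /\ forall e, T e -> x ** s e = 0.

(** A nonzero product forces [e] to start at the supporting vertex. From [H] it stays in [H] by
    heredity; from [V], edges in [T] kill [x] and all others lead into [H]. *)
Lemma supported_s H V T x e : hereditary H ->
  (forall e, V (src e) -> ~ T e -> H (rng e)) ->
  supported H V T x -> x ** s e = 0 \/ supported H V T (x ** s e).
Proof.
move=> hH VH [w xw HV]; have [we|we] := pselect (w = src e); last first.
  by left; rewrite -xw -cmulA (ck_p_s ck) ?cmulx0.
have [Te|nTe] := pselect (V w /\ T e).
  case: HV => [Hw|[_ xT]]; last by left; apply: xT; case: Te.
  right; exists (rng e); first by rewrite -cmulA (ck_s_rng ck).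
  by left; apply: hH; rewrite -we.
right; exists (rng e); first by rewrite -cmulA (ck_s_rng ck).
left; case: HV => [Hw|[Vw _]]; first by apply: hH; rewrite -we.
by apply: VH; rewrite -?we// => Te; apply: nTe.
Qed.

Lemma supported_p H V T x v : supported H V T x -> x ** p v = 0 \/ x ** p v = x.
Proof.
move=> [w xw _]; have [<-|vw] := pselect (w = v); first by right.
by left; rewrite -xw -cmulA (ck_orthogonal ck vw) cmulx0.
Qed.

(** Induction on monomials: a left factor [s_e] of [a] is absorbed into [x], and a right factor
    [s_e^*] into [y]. At a vertex projection a nonzero product would need one vertex supporting both
    sides, which disjointness excludes. *)
Lemma supported_orthogonal H1 V1 T1 H2 V2 T2 :
  hereditary H1 -> (forall e, V1 (src e) -> ~ T1 e -> H1 (rng e)) ->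
  hereditary H2 -> (forall e, V2 (src e) -> ~ T2 e -> H2 (rng e)) ->
  (forall v, (H1 `|` V1) v -> (H2 `|` V2) v -> False) ->
  forall a x y, supported H1 V1 T1 x -> supported H2 V2 T2 y ->
    x ** a ** cstar y = 0.
Proof.
move=> hH1 VH1 hH2 VH2 disj a.
pose S : set U := [set a | forall x, supported H1 V1 T1 x ->
  forall y, supported H2 V2 T2 y -> x ** a ** cstar y = 0].
suff Sa : S a by move=> x y hx hy; exact: Sa.
move: a; apply: (@monomial_closedT _ _ U); split=> /=.
- apply: closed_forall => x; apply: closed_forall => _;
    apply: closed_forall => y.
  apply: closed_forall => _.
  apply: (@closed_lipschitz_preimage _ _ _ _ [set z | z = 0]).
    exact: lipschitz_map_comp (lipschitz_mulr _) (lipschitz_mull _).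
  exact: closed_singleton0.
- by move=> x _ y _; rewrite cmulx0 cmul0x.
- move=> a b Sa Sb x hx y hy.
  by rewrite cmulDr cmulDl Sa// Sb// addr0.
- by move=> c a Sa x hx y hy; rewrite cmulZr cmulZl Sa// scaler0.
- move=> v x [w xw HV] y [w' yw' HV']; have [vw|vw] := pselect (w = v);
    last first.
    by rewrite -xw -[x ** p w ** p v]cmulA (ck_orthogonal ck vw) cmulx0 cmul0x.
  rewrite -yw' cstarM (ck_cstar_p ck) -cmulA [p v ** _]cmulA.
  rewrite (ck_orthogonal ck) ?cmul0x ?cmulx0// => vw'.
  apply: (disj v); first by rewrite -vw; case: HV => [?|[]]; [left|right].
  by rewrite vw'; case: HV' => [?|[]]; [left|right].
- move=> v a Sa x hx y hy; rewrite cmulA.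
  by have [->|->] := supported_p v hx; rewrite ?cmul0x//; exact: Sa.
- move=> v a Sa x hx y hy; rewrite cmulA -cmulA -{1}(ck_cstar_p ck v) -cstarM.
  by have [->|->] := supported_p v hy; rewrite ?cstar0 ?cmulx0//; exact: Sa.
- move=> e a Sa x hx y hy; rewrite cmulA.
  by have [->|hxs] := supported_s e hH1 VH1 hx; rewrite ?cmul0x//; exact: Sa.
- move=> e a Sa x hx y hy; rewrite cmulA -cmulA -cstarM.
  by have [->|hys] := supported_s e hH2 VH2 hy; rewrite ?cstar0 ?cmulx0//;
    exact: Sa.
Qed.

Lemma supported_kernel_generators (F : relgraph) (a : relmorph F E) x :
  kernel_generators a U x ->
  supported (~` range (mvtx a)) (mvtx a @` new_marked a) (range (medg a)) x.
Proof.
move=> [[v nv <-]|[v [mv nmv] <-]].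
  by exists v; [rewrite (ck_pp ck)|left].
exists (mvtx a v); first exact: gap_p.
by right; split; [exists v|move=> e; exact: gap_s].
Qed.

End Orthogonality.

(** * Continuity of maps into normed spaces and C*-algebras *)

Section Continuity.
Context {R : realType}.

Lemma continuous_rnormP (T : topologicalType) (V : normedModType R[i]) (f : T
  -> V) :
  continuous f <->
  forall x (e : R), 0 < e -> nbhs x [set y | rnorm (f x - f y) < e].
Proof.
split=> [cf x e e0|cf x P /nbhs_rnormP[e e0 eP]].
  by apply: (cf x [set y | rnorm (f x - y) < e]); apply/nbhs_rnormP; exists e.
by apply: filterS (cf x e e0) => y; exact: eP.
Qed.

Lemma continuous_lipschitz (V W : normedModType R[i]) (f : V -> W) :
  lipschitz_map f -> continuous f.
Proof.
move=> [K K0 fK]; apply/continuous_rnormP => x e e0; have K1 : 0 < K + 1 by lra.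
apply/nbhs_rnormP; exists (e / (K + 1)); first by rewrite divr_gt0.
move=> y; rewrite ltr_pdivlMr// => xy; apply: le_lt_trans (fK _ _) _.
apply: le_lt_trans xy.
by rewrite mulrC ler_wpM2l ?rnorm_ge0// lerDl.
Qed.

Lemma continuous_rnormD (T : topologicalType) (V : normedModType R[i])
  (f g : T -> V) :
  continuous f -> continuous g -> continuous (fun x => f x + g x).
Proof.
move=> /continuous_rnormP cf /continuous_rnormP cg.
apply/continuous_rnormP => x e e0; have e2 : 0 < e / 2 by rewrite divr_gt0.
apply: filterS (filterI (cf x _ e2) (cg x _ e2)) => y [fxy gxy] /=.
rewrite opprD addrACA [e]splitr; apply: le_lt_trans (rnormD _ _) _.
exact: ltrD.
Qed.

Lemma continuous_cmul (T : topologicalType) (A : cstarAlgType R) (f g : T -> A)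
  (K : R) : (forall x, rnorm (f x) <= K) -> (forall x, rnorm (g x) <= K) ->
  continuous f -> continuous g -> continuous (fun x => cmul (f x) (g x)).
Proof.
move=> fK gK /continuous_rnormP cf /continuous_rnormP cg.
apply/continuous_rnormP => x e e0.
have K0 : 0 <= K by exact: le_trans (rnorm_ge0 _) (fK x).
have K1 : 0 < 2 * K + 1 by lra.
have d0 : 0 < e / (2 * K + 1) by rewrite divr_gt0.
apply: filterS (filterI (cf x _ d0) (cg x _ d0)) => y [fxy gxy] /=.
apply: le_lt_trans (rnormB_triangle (cmul (f x) (g y)) _ _) _.
rewrite -cmulBr -cmulBl.
have de : e / (2 * K + 1) * (2 * K + 1) = e by rewrite divfK// gt_eqF.
have := lerD (rnormM (f x) (g x - g y)) (rnormM (f x - f y) (g y)).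
move=> /le_lt_trans; apply; move: fxy gxy (fK x) (gK y) => /=.
have := rnorm_ge0 (f x); have := rnorm_ge0 (g y).
have := rnorm_ge0 (g x - g y); have := rnorm_ge0 (f x - f y).
move: d0 de; set d := e / _; nra.
Qed.

(** The three-epsilon argument, for a family of maps that are all 1-Lipschitz. *)
Lemma closed_continuous (T : topologicalType) (V W : normedModType R[i])
  (f : T -> V -> W) :
  (forall t x y, rnorm (f t x - f t y) <= rnorm (x - y)) ->
  closed [set x | continuous (fun t => f t x)].
Proof.
move=> f1; apply/closed_rnormP => x xS; apply/continuous_rnormP => t e e0.
have e3 : 0 < e / 3 by rewrite divr_gt0.
have [y /continuous_rnormP cy xy] := xS _ e3.
apply: filterS (cy t _ e3) => u /= tu.
apply: le_lt_trans (rnormB_triangle (f t y) _ _) _.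
have := rnormB_triangle (f u y) (f t y) (f u x).
have := f1 t x y; have := f1 u y x; rewrite (rnormBC y x); lra.
Qed.

End Continuity.

Section GaugeAction.
Context {R : realType} {E : relgraph} (U : relgraph_calg R E).

Lemma star_hom_gauge z : star_hom (gauge U z).
Proof. exact: universal_map_hom. Qed.

Lemma gauge_p z v : gauge U z (calg_p U v) = calg_p U v.
Proof. exact: universal_map_p. Qed.

Lemma gauge_s z e : gauge U z (calg_s U e) = (val z : R[i]) *: calg_s U e.
Proof. exact: universal_map_s. Qed.

Lemma circle_action_gauge : circle_action (gauge U).
Proof.
split.
- exact: star_hom_gauge.
- apply: (calg_hom_ext (f := gauge U circle1) (g := fun x => x)).
  + exact: star_hom_gauge.
  + exact: star_hom_id.
  + by move=> v; rewrite gauge_p.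
  + by move=> e; rewrite gauge_s scale1r.
- move=> z w; apply: (calg_hom_ext (f := gauge U (circle_mul z w))
    (g := fun x => gauge U z (gauge U w x))).
  + exact: star_hom_gauge.
  + exact: star_hom_comp (star_hom_gauge z) (star_hom_gauge w).
  + by move=> v; rewrite !gauge_p.
  + by move=> e; rewrite !gauge_s star_homZ ?gauge_s ?scalerA 1?mulrC//;
      exact: star_hom_gauge.
(* The elements with continuous orbit form a closed *-subalgebra, so only the generators have to be
   inspected. *)
- suff /seteqP[_ h] : [set a | continuous (fun z => gauge U z a)] = setT.
    by move=> a; exact: (h a Logic.I).
  apply: (@calg_generated _ _ U); first split=> /=.
  + by under [X in continuous X]funext do rewrite (star_hom0 (star_hom_gauge
      _));
      exact: cst_continuous.
  + move=> x y cx cy.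
    under [X in continuous X]funext do rewrite (star_homD (star_hom_gauge _)).
    exact: continuous_rnormD.
  + move=> a x cx.
    under [X in continuous X]funext do rewrite (star_homZ (star_hom_gauge _)).
    move=> z; apply: (@continuous_comp _ _ _ (gauge U ^~ x) (fun y : U => a *:
      y)).
      exact: cx.
    exact: continuous_lipschitz (lipschitz_mapZ a (lipschitz_map_id U)) _.
  + move=> x y cx cy.
    under [X in continuous X]funext do rewrite (star_homM (star_hom_gauge _)).
    apply: (@continuous_cmul _ _ _ _ _ (rnorm x + rnorm y)) => // z.
      by rewrite (le_trans (star_hom_contractive (star_hom_gauge z) _))//
        lerDl rnorm_ge0.
    by rewrite (le_trans (star_hom_contractive (star_hom_gauge z) _))//
      lerDr rnorm_ge0.
  + move=> x cx.
    under [X in continuous X]funext do rewrite (star_hom_star (star_hom_gauge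
      _)).
    move=> z; apply: (@continuous_comp _ _ _ (gauge U ^~ x) (@cstar R U));
      first exact: cx.
    exact: continuous_lipschitz lipschitz_star _.
  + apply: closed_continuous => z x y.
    by rewrite -(star_homB (star_hom_gauge z)) star_hom_contractive//;
      exact: star_hom_gauge.
  + move=> _ [v _ <-] /=.
    under [X in continuous X]funext do rewrite gauge_p.
    exact: cst_continuous.
  + move=> _ [e _ <-] /=.
    under [X in continuous X]funext do rewrite gauge_s.
    move=> z; apply: (@continuous_comp _ R[i]^o _ (fun z : unit_circle R =>
      val z)
      (fun c : R[i]^o => (c : R[i]) *: calg_s U e)).
      exact: initial_continuous.
    apply: continuous_lipschitz; exists (rnorm (calg_s U e));
      first exact: rnorm_ge0.
    by move=> c d; rewrite -scalerBl rnormZ mulrC.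
Qed.

End GaugeAction.

Lemma equivariant_gauge (R : realType) (E F : relgraph) (U : relgraph_calg R E)
  (UF : relgraph_calg R F) (f : U -> UF) :
  star_hom f ->
  (forall z v, gauge UF z (f (calg_p U v)) = f (calg_p U v)) ->
  (forall z e, gauge UF z (f (calg_s U e)) = (val z : R[i]) *: f (calg_s U e))
    ->
  equivariant (gauge U) (gauge UF) f.
Proof.
move=> hf fp fs z; apply: (calg_hom_ext (f := fun x => f (gauge U z x))
  (g := fun x => gauge UF z (f x))).
- exact: star_hom_comp hf (star_hom_gauge U z).
- exact: star_hom_comp (star_hom_gauge UF z) hf.
- by move=> v; rewrite gauge_p fp.
- by move=> e; rewrite gauge_s star_homZ// fs.
Qed.

(** * The pullback *)

Lemma equivariant_canonical (R : realType) (F E : relgraph) (a : relmorph F E)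
  (UE : relgraph_calg R E) (UF : relgraph_calg R F) :
  equivariant (gauge UE) (gauge UF) (canonical_surjection a UE UF).
Proof.
apply: equivariant_gauge; first exact: star_hom_canonical.
- move=> z v; have [[v' _ <-]|nv] := pselect (range (mvtx a) v).
    by rewrite canonical_surjection_p gauge_p.
  by rewrite canonical_surjection_p_out// (star_hom0 (star_hom_gauge UF z)).
- move=> z e; have [[e' _ <-]|ne] := pselect (range (medg a) e).
    by rewrite canonical_surjection_s gauge_s.
  by rewrite canonical_surjection_s_out//
    (star_hom0 (star_hom_gauge UF z)) scaler0.
Qed.

Section Pullback.
Context {R : realType} {F0 F1 F2 : relgraph}.
Context (a1 : relmorph F0 F1) (a2 : relmorph F0 F2).
Context (CE : relgraph_calg R (pushout a1 a2)).
Context (C1 : relgraph_calg R F1) (C2 : relgraph_calg R F2).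
Context (C0 : relgraph_calg R F0).
Local Notation E := (pushout a1 a2).
Local Notation i1 := (pushout_in1 a1 a2).
Local Notation i2 := (pushout_in2 a1 a2).
Local Notation rho1 := (canonical_surjection i1 CE C1).
Local Notation rho2 := (canonical_surjection i2 CE C2).
Local Notation mu1 := (canonical_surjection a1 C1 C0).
Local Notation mu2 := (canonical_surjection a2 C2 C0).
Local Notation J1 := (ideal_span (kernel_generators i1 CE)).
Local Notation J2 := (ideal_span (kernel_generators i2 CE)).

Let hr1 : star_hom rho1. Proof. exact: star_hom_canonical. Qed.
Let hr2 : star_hom rho2. Proof. exact: star_hom_canonical. Qed.
Let hm1 : star_hom mu1. Proof. exact: star_hom_canonical. Qed.
Let hm2 : star_hom mu2. Proof. exact: star_hom_canonical. Qed.
Let hJ1 := closed_ideal_span (kernel_generators i1 CE).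
Let hJ2 := closed_ideal_span (kernel_generators i2 CE).

Lemma pushout_mvtx12 v : mvtx i1 (mvtx a1 v) = mvtx i2 (mvtx a2 v).
Proof. exact: glue12. Qed.

Lemma pushout_medg12 e : medg i1 (medg a1 e) = medg i2 (medg a2 e).
Proof. exact: glue12. Qed.

Lemma pushout_mvtx12P v1 v2 : mvtx i1 v1 = mvtx i2 v2 ->
  exists v, v1 = mvtx a1 v /\ v2 = mvtx a2 v.
Proof. by apply: glue12P; exact: mvtx_inj. Qed.

Lemma pushout_medg12P e1 e2 : medg i1 e1 = medg i2 e2 ->
  exists e, e1 = medg a1 e /\ e2 = medg a2 e.
Proof. by apply: glue12P; exact: medg_inj. Qed.

Lemma pushout_mvtxP (v : vtx E) :
  (exists v1, v = mvtx i1 v1) \/ (exists v2, v = mvtx i2 v2).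
Proof. exact: pushout_vtxP. Qed.

Lemma pushout_medgP (e : edg E) :
  (exists e1, e = medg i1 e1) \/ (exists e2, e = medg i2 e2).
Proof. exact: pushout_edgP. Qed.

(** On generators: those of [F0] are kept by both composites, and those outside [F0] belong to only
    one of [F1], [F2], so both composites kill them. *)
Lemma pushout_comm x : mu1 (rho1 x) = mu2 (rho2 x).
Proof.
apply: (calg_hom_ext (f := fun x => mu1 (rho1 x)) (g := fun x => mu2 (rho2 x))).
- exact: star_hom_comp.
- exact: star_hom_comp.
- move=> v; have [[v1 ->]|[v2 ->]] := pushout_mvtxP v.
  + rewrite (canonical_surjection_p i1).
    have [[v0 _ <-]|nv] := pselect (range (mvtx a1) v1).
      rewrite pushout_mvtx12 canonical_surjection_p.
      by rewrite canonical_surjection_p canonical_surjection_p.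
    rewrite canonical_surjection_p_out//
      canonical_surjection_p_out ?(star_hom0 hm2)//.
    by move=> [v2 _ /esym/pushout_mvtx12P[v0 [vv _]]]; apply: nv; exists v0.
  + rewrite (canonical_surjection_p i2).
    have [[v0 _ <-]|nv] := pselect (range (mvtx a2) v2).
      rewrite -pushout_mvtx12 canonical_surjection_p.
      by rewrite canonical_surjection_p canonical_surjection_p.
    rewrite [RHS]canonical_surjection_p_out//
      canonical_surjection_p_out ?(star_hom0 hm1)//.
    by move=> [v1 _ /pushout_mvtx12P[v0 [_ vv]]]; apply: nv; exists v0.
- move=> e; have [[e1 ->]|[e2 ->]] := pushout_medgP e.
  + rewrite (canonical_surjection_s i1).
    have [[e0 _ <-]|ne] := pselect (range (medg a1) e1).
      rewrite pushout_medg12 canonical_surjection_s.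
      by rewrite canonical_surjection_s canonical_surjection_s.
    rewrite canonical_surjection_s_out//
      canonical_surjection_s_out ?(star_hom0 hm2)//.
    by move=> [e2 _ /esym/pushout_medg12P[e0 [ee _]]]; apply: ne; exists e0.
  + rewrite (canonical_surjection_s i2).
    have [[e0 _ <-]|ne] := pselect (range (medg a2) e2).
      rewrite -pushout_medg12 canonical_surjection_s.
      by rewrite canonical_surjection_s canonical_surjection_s.
    rewrite [RHS]canonical_surjection_s_out//
      canonical_surjection_s_out ?(star_hom0 hm1)//.
    by move=> [e1 _ /pushout_medg12P[e0 [_ ee]]]; apply: ne; exists e0.
Qed.

(** It is enough to treat generators with an arbitrary element in between, and this reduces to
    disjointness of the two sets of supporting vertices. *)
Lemma pushout_kernels_orthogonal x y : J1 x -> J2 y -> cmul x y = 0.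
Proof.
apply: ideal_span_mul_eq0; try exact: kernel_generators_self_adjoint.
move=> {}x {}y a Gx Gy.
rewrite -(kernel_generators_self_adjoint Gy).
apply: (supported_orthogonal _ _ _ _ _ a (supported_kernel_generators Gx)
  (supported_kernel_generators Gy)).
- exact: relmorph_hereditary.
- by move=> e _; exact: rng_out_range.
- exact: relmorph_hereditary.
- by move=> e _; exact: rng_out_range.
move=> v hv1 hv2.
have m12 v1 v2 : v = mvtx i1 v1 -> v = mvtx i2 v2 -> marked F1 v1 ->
    marked F2 v2 -> marked E v.
  by move=> vv1 vv2 m1 m2; right; split; [exists v1|exists v2].
(* Each case contradicts the form of the pushout: every vertex comes from [F1] or [F2]; a vertex
   marked in one of them and absent from the other stays marked; a vertex marked in both stays
   marked. *)
case: hv1 hv2 => [nv1|[v1 [mv1 nm1] vv1]] [nv2|[v2 [mv2 nm2] vv2]].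
- by have [[w vw]|[w vw]] := pushout_mvtxP v; [apply: nv1|apply: nv2]; exists w.
- apply: nm2; left; right; split; first by exists v2.
  by move=> [v0 _ v0v]; apply: nv1; exists (mvtx a1 v0); rewrite // -vv2.
- apply: nm1; left; left; split; first by exists v1.
  move=> [v0 _ v0v]; apply: nv2; exists (mvtx a2 v0) => //.
  by rewrite -pushout_mvtx12 -vv1.
- by apply: nm1; rewrite vv1; apply: (m12 v1 v2).
Qed.

(** The difference [z] lies in both kernels, so [z^* z] is in [J1 J2 = 0]. *)
Lemma pullback_injective x y : rho1 x = rho1 y -> rho2 x = rho2 y -> x = y.
Proof.
move=> xy1 xy2; apply: subr0_eq; apply: cstarM_eq0.
apply: pushout_kernels_orthogonal.
  apply: (closed_ideal_star hJ1); apply/(canonical_kernel i1 C1).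
  by rewrite (star_homB hr1) xy1 subrr.
by apply/(canonical_kernel i2 C2); rewrite (star_homB hr2) xy2 subrr.
Qed.

(* As [J1 J2 = 0], the norm of [j] in [J2] is its distance to [J1], which is
   the norm of [rho1 j]. *)
Lemma rnorm_rho1 j : J2 j -> rnorm j <= rnorm (rho1 j).
Proof.
move=> Jj; apply: eps_le => e e0.
have [i Ji /ltW le] := canonical_lift_norm i1 C1 j e0.
apply: le_trans le.
have [->|j0] := eqVneq (rnorm j) 0; first exact: rnorm_ge0.
have jp : 0 < rnorm j by rewrite lt_def j0 rnorm_ge0.
have : rnorm (cmul (j - i) (cstar j)) <= rnorm (j - i) * rnorm j.
  by rewrite -(rnorm_star j) rnormM.
rewrite cmulBl (pushout_kernels_orthogonal Ji);
  last exact: (closed_ideal_star hJ2).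
by rewrite subr0 -{1}(cstarK j) rnormMstar rnorm_star expr2 ler_pM2r.
Qed.

(** The image is an ideal because [rho1] is onto. It is closed because [rho1] does not shrink norms
    on [J2]: preimages of a fast convergent sequence form a Cauchy sequence in the closed set
    [J2]. *)
Lemma closed_ideal_rho1 : closed_ideal (rho1 @` J2).
Proof.
split.
- by exists 0; [exact: closed_ideal0 hJ2|exact: star_hom0].
- move=> _ _ [x Jx <-] [y Jy <-]; exists (x + y); last exact: star_homD.
  exact: (closed_idealD hJ2).
- move=> c _ [x Jx <-]; exists (c *: x); last exact: star_homZ.
  exact: (closed_idealZ hJ2).
- move=> y _ [x Jx <-]; have [y' <-] := canonical_surjective i1 CE y.
  exists (cmul y' x); last exact: star_homM.
  exact: (closed_idealMl hJ2).
- move=> _ y [x Jx <-]; have [y' <-] := canonical_surjective i1 CE y.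
  exists (cmul x y'); last exact: star_homM.
  exact: (closed_idealMr hJ2).
- move=> _ [x Jx <-]; exists (cstar x); last exact: star_hom_star.
  exact: (closed_ideal_star hJ2).
apply/closed_rnormP => y yJ.
pose h n : R := (2^-1) ^+ n.
have h0 n : 0 < h n by rewrite exprn_gt0 ?invr_gt0.
have hS n : h n.+1 <= h n
  by rewrite /h exprS ler_piMl ?(ltW (h0 n))// invf_le1// ler1n.
have /choice[u uJ] : forall n, exists x, J2 x /\ rnorm (y - rho1 x) < h n.
  by move=> n; have [_ [x Jx <-] yx] := yJ _ (h0 n); exists x.
have [l ul] : exists l, forall e : R, 0 < e ->
    exists N, forall n, (N <= n)%N -> rnorm (u n - l) < e.
  apply: (@geometric_cvg _ _ _ 2 2^-1); first by rewrite invr_ge0.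
    by rewrite invf_lt1// ltr1n.
  move=> n; have Jd : J2 (u n.+1 - u n).
    by apply: (closed_idealB hJ2); [exact: (uJ n.+1).1|exact: (uJ n).1].
  apply: le_trans (rnorm_rho1 Jd) _; rewrite (star_homB hr1).
  apply: le_trans (rnormB_triangle y _ _) _; rewrite rnormBC.
  by have := (uJ n.+1).2; have := (uJ n).2; have := hS n; rewrite /h; lra.
exists l.
  move/closed_rnormP: (closed_ideal_closed hJ2); apply => e e0.
  have [N uN] := ul _ e0; exists (u N); first exact: (uJ N).1.
  by rewrite rnormBC uN.
apply/subr0_eq/rnorm_eps0 => e e0; have e2 : 0 < e / 2 by rewrite divr_gt0.
have [N uN] := ul _ e2.
have [|//|M hM] := @exp_small R 2^-1 1 (e / 2) _ _ e2;
  first by rewrite invr_ge0.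
  by rewrite invf_lt1// ltr1n.
pose n := maxn N M.
apply: le_trans (rnormB_triangle (rho1 (u n)) _ _) _.
rewrite -(star_homB hr1) rnormBC [e]splitr lerD//.
  apply: le_trans (star_hom_contractive hr1 _) _.
  by rewrite rnormBC; apply/ltW/uN; rewrite leq_maxl.
apply: le_trans (ltW (uJ n).2) _.
by rewrite -[h n]mul1r; apply/ltW/hM; rewrite leq_maxr.
Qed.

(** A vertex of [F1] outside [F0] is outside [F2]. A vertex of [F0] marked there but not in [F1] is
    marked in [F2] by admissibility, and its gap relative to [F2] is mapped to its gap relative to
    [F0]. *)
Lemma kernel_generators_rho1 : admissible a1 a2 ->
  (kernel_generators a1 C1) `<=` rho1 @` J2.
Proof.
move=> adm _ [[v nv <-]|[v [mv nmv] <-]].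
  exists (calg_p CE (mvtx i1 v)); last exact: canonical_surjection_p.
  apply: ideal_span_sub; left; exists (mvtx i1 v) => //.
  by move=> [v2 _ /esym/pushout_mvtx12P[v0 [vv _]]]; apply: nv; exists v0.
have mv2 : marked F2 (mvtx a2 v) by have [] := adm v mv.
exists (gap i2 CE (mvtx a2 v)).
  apply: ideal_span_sub; right; exists (mvtx a2 v) => //; split => // mE.
  (* If the vertex were marked in the pushout, the marking condition for the inclusion of [F1] would
     make it marked in [F1]. *)
  apply: nmv; have [|w mw] := @relmorph_marked _ _ i1 (mvtx i2 (mvtx a2 v)).
    by split => //; exists (mvtx a1 v) => //; exact: pushout_mvtx12.
  by rewrite -pushout_mvtx12 => /mvtx_inj <-.
rewrite /gap (star_homB hr1) (star_hom_fsum _ hr1);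
  last exact: finite_out_edges.
rewrite -pushout_mvtx12 canonical_surjection_p; congr (_ - _).
pose g e := rho1 (cmul (calg_s CE (medg i2 e)) (cstar (calg_s CE (medg i2 e)))).
(* [rho1] kills the edges of [F2] that are not in [F0], so the sum over edges of [F2] shrinks to one
   over edges of [F0]. *)
rewrite -(fsbig_out_edges (g := g)) => [|e ne].
  apply: eq_fsbigr => e _;
    rewrite /g -pushout_medg12 (star_homM hr1) (star_hom_star hr1).
  by rewrite canonical_surjection_s.
rewrite /g (star_homM hr1) canonical_surjection_s_out ?cmul0x//.
by move=> [e1 _ /pushout_medg12P[e0 [_ ee]]]; apply: ne; exists e0.
Qed.

(** Lift [x2] to [y2]. The error [x1 - rho1 y2] lies in the kernel of [mu1], hence is [rho1 j] with
    [j] in [J2]; adding [j] corrects the first coordinate and leaves the second unchanged. *)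
Lemma pullback_surjective x1 x2 : admissible a1 a2 -> mu1 x1 = mu2 x2 ->
  exists x, rho1 x = x1 /\ rho2 x = x2.
Proof.
move=> adm x12; have [y2 y2E] := canonical_surjective i2 CE x2.
have : ideal_span (kernel_generators a1 C1) (x1 - rho1 y2).
  by apply/(canonical_kernel a1 C0);
    rewrite (star_homB hm1) pushout_comm y2E x12 subrr.
move=> /(ideal_span_min closed_ideal_rho1 (kernel_generators_rho1 adm))[j Jj
  jE].
exists (j + y2); rewrite (star_homD hr1) (star_homD hr2) jE subrK; split=> //.
by rewrite (canonical_kernel i2 C2 j).2// add0r.
Qed.

End Pullback.

Theorem theorem4p7 (R : realType) (F0 F1 F2 : relgraph)
  (a1 : relmorph F0 F1) (a2 : relmorph F0 F2)
  (CE : relgraph_calg R (pushout a1 a2))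
  (C1 : relgraph_calg R F1) (C2 : relgraph_calg R F2)
  (C0 : relgraph_calg R F0) :
  admissible a1 a2 ->
  pullback_diagram (gauge CE) (gauge C1) (gauge C2) (gauge C0)
    (canonical_surjection (pushout_in1 a1 a2) CE C1)
    (canonical_surjection (pushout_in2 a1 a2) CE C2)
    (canonical_surjection a1 C1 C0)
    (canonical_surjection a2 C2 C0).
Proof.
move=> adm; split.
- by split; exact: circle_action_gauge.
- by split; exact: star_hom_canonical.
- by split; exact: equivariant_canonical.
- exact: pushout_comm.
have h1 := star_hom_canonical (pushout_in1 a1 a2) CE C1.
have h2 := star_hom_canonical (pushout_in2 a1 a2) CE C2.
split.
- split=> [x y|c x|x y|x].
  + by rewrite (star_homD h1) (star_homD h2).
  + by rewrite (star_homZ h1) (star_homZ h2).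
  + by rewrite (star_homM h1) (star_homM h2).
  + by rewrite (star_hom_star h1) (star_hom_star h2).
- by move=> z x; rewrite /dsum_action /= !equivariant_canonical.
split.
- by move=> x _; exact: pushout_comm.
- by move=> x y _ _ [x1 x2]; exact: pullback_injective x1 x2.
- move=> [x1 x2] /= x12; have [x [xE1 xE2]] := pullback_surjective CE adm x12.
  by exists x => //; rewrite xE1 xE2.
Qed.
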